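(* Let $\mathcal{C}$ be a $d$-uniform clutter with a perfect matching such that $\mathcal{C}$ has the packing property and $\alpha_0(\mathcal{C})=2$. Let $v_1,\ldots,v_q$ be the column vectors of the incidence matrix $A$ of $\mathcal{C}$. If $v_1,\ldots,v_q$ are linearly independent, then $\mathcal{C}$ has the max-flow min-cut property.
   Context: A clutter $\mathcal{C}$ with finite vertex set $X=\{x_1,\ldots,x_n\}$ is a family of subsets of $X$ (called edges), none of which is included in another. Standing assumption: $\mathcal{C}$ has no isolated vertices, i.e., each vertex lies in at least one edge. $\mathcal{C}$ is $d$-uniform if every edge has exactly $d$ vertices. If $f_1,\ldots,f_q$ are the edges, the incidence matrix $A$ is the $n\times q$ matrix whose columns are $v_k=\sum_{x_i\in f_k}e_i\in\{0,1\}^n$. A minimal vertex cover is a subset of $X$ meeting every edge and minimal under inclusion with this property; $\alpha_0(\mathcal{C})$ is the smallest cardinality of a minimal vertex cover, and $\beta_1(\mathcal{C})$ is the maximum number of pairwise disjoint edges. A perfect matching is a set of pairwise disjoint edges whose union is $X$. The edge ideal of $\mathcal{C}$ is $I=I(\mathcal{C})=(x^{v_1},\ldots,x^{v_q})\subset R=K[x_1,\ldots,x_n]$, $K$ a field; this gives a one-to-one correspondence between clutters and square-free monomial ideals (the edges are the supports of the minimal monomial generators). A minor of $I$ is a proper ideal $I'$ of $R$ obtained from $I$ by setting some (possibly empty) set of variables equal to $0$ and some disjoint (possibly empty) set of variables equal to $1$ in the generators; a minor of $\mathcal{C}$ is a clutter corresponding to a minor of $I$. $\mathcal{C}$ satisfies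 the K\''onig property if $\alpha_0(\mathcal{C})=\beta_1(\mathcal{C})$, and satisfies the packing property if all its minors (including $\mathcal{C}$ itself) satisfy the K\''onig property. $\mathcal{C}$ has the max-flow min-cut property if for every non-negative integral vector $\alpha\in\mathbb{N}^n$ both sides of the LP-duality equation $\min\{\langle\alpha,x\rangle \mid x\geq 0,\ xA\geq\mathbf{1}\}=\max\{\langle y,\mathbf{1}\rangle \mid y\geq 0,\ Ay\leq\alpha\}$ have integral optimum solutions $x$ and $y$, where $\mathbf{1}=(1,\ldots,1)$. *)

(* Defs.v *)
From HB Require Import structures.
From mathcomp Require Import all_boot all_order all_algebra.
From mathcomp Require Import mpoly.

Set Implicit Arguments.
Unset Strict Implicit.
Unset Printing Implicit Defensive.

Import Order.TTheory GRing.Theory Num.Theory.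
Local Open Scope ring_scope.

(* A family of edges on the vertex set X = 'I_n is a set C : {set {set 'I_n}}. *)

Section Clutters.

Variable n : nat.
Implicit Types (C M : {set {set 'I_n}}) (S : {set 'I_n}).

Definition clutter C : Prop :=
  forall f g, f \in C -> g \in C -> f \subset g -> f = g.

Definition no_isolated_vertices C : Prop :=
  forall i : 'I_n, exists2 f, f \in C & i \in f.

Definition uniform (d : nat) C : Prop := forall f, f \in C -> #|f| = d.

Definition vertex_cover C S : bool := [forall f in C, S :&: f != set0].

Definition minimal_vertex_cover C S : bool := minset (vertex_cover C) S.

(* The default n is never smaller than the size of a cover. It is returned as
   a default only when C has no cover, i.e. when set0 is an edge of C. *)
Definition alpha0 C : nat :=
  \big[minn/n]_(S | minimal_vertex_cover C S) #|S|.

Definition beta1 C : nat :=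
  \max_(M : {set {set 'I_n}} | (M \subset C) && trivIset M) #|M|.

Definition perfect_matching C M : Prop :=
  [/\ M \subset C, trivIset M & cover M = [set: 'I_n]].

Definition konig C : Prop := alpha0 C = beta1 C.

End Clutters.

Section Minors.

Variables (K : fieldType) (n : nat).
Implicit Types (C D : {set {set 'I_n}}) (Z W : {set 'I_n}).

Definition ideal_of (G : seq {mpoly K[n]}) (p : {mpoly K[n]}) : Prop :=
  exists c : 'I_(size G) -> {mpoly K[n]},
    p = \sum_(i < size G) c i * G`_i.

Definition edge_monomial (f : {set 'I_n}) : {mpoly K[n]} := \prod_(i in f) 'X_i.

Definition edge_generators C : seq {mpoly K[n]} :=
  [seq edge_monomial f | f <- enum C].

Definition edge_ideal C : {mpoly K[n]} -> Prop := ideal_of (edge_generators C).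

(* Set the variables in Z to 0 and those in W to 1. *)
Definition set_vars Z W (p : {mpoly K[n]}) : {mpoly K[n]} :=
  p \mPo [tuple (if i \in Z then 0 else if i \in W then 1 else 'X_i) | i < n].

(* The ideal of the minor lives in the same ring K[x_1,...,x_n], so a minor of
   C is again a family of subsets of 'I_n; the vertices in Z and W, and possibly
   others, lie in none of its edges, which affects neither alpha0 nor beta1. *)
Definition clutter_minor C D : Prop :=
  exists Z W : {set 'I_n},
    let I' := ideal_of [seq set_vars Z W g | g <- edge_generators C] in
    [/\ [disjoint Z & W], ~ I' 1, clutter D
      & forall p, edge_ideal D p <-> I' p].

Definition packing_property C : Prop :=
  forall D, clutter_minor C D -> konig D.

End Minors.

Section MaxFlowMinCut.

Variables (R : realFieldType) (n : nat).
Implicit Type C : {set {set 'I_n}}.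

Definition incidence_matrix C : 'M[R]_(n, #|C|) :=
  \matrix_(i, k) (i \in (enum_val k : {set 'I_n}))%:R.

Definition min_feasible q (A : 'M[R]_(n, q)) (x : 'rV[R]_n) : Prop :=
  (forall i, 0 <= x 0 i) /\ (forall k, 1 <= (x *m A) 0 k).

Definition min_value (a : 'I_n -> nat) (x : 'rV[R]_n) : R :=
  \sum_i (a i)%:R * x 0 i.

Definition min_optimal q (A : 'M[R]_(n, q)) (a : 'I_n -> nat)
    (x : 'rV[R]_n) : Prop :=
  min_feasible A x /\
  forall x', min_feasible A x' -> min_value a x <= min_value a x'.

Definition max_feasible q (A : 'M[R]_(n, q)) (a : 'I_n -> nat)
    (y : 'cV[R]_q) : Prop :=
  (forall k, 0 <= y k 0) /\ (forall i, (A *m y) i 0 <= (a i)%:R).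

Definition max_value q (y : 'cV[R]_q) : R := \sum_k y k 0.

Definition max_optimal q (A : 'M[R]_(n, q)) (a : 'I_n -> nat)
    (y : 'cV[R]_q) : Prop :=
  max_feasible A a y /\
  forall y', max_feasible A a y' -> max_value y' <= max_value y.

Definition max_flow_min_cut C : Prop :=
  forall a : 'I_n -> nat,
    (exists x : 'rV[int]_n,
       min_optimal (incidence_matrix C) a (map_mx intr x)) /\
    (exists y : 'cV[int]_(#|C|),
       max_optimal (incidence_matrix C) a (map_mx intr y)).

End MaxFlowMinCut.

(* Main.v *)
Require Import Defs.
From HB Require Import structures.
From mathcomp Require Import all_boot all_order all_algebra.
From mathcomp Require Import mpoly.
From mathcomp Require Import zify.

(* Write X = 'I_n. As alpha0 = 2, uniformity and the perfect matching give two
   complementary edges f0 and ~: f0; replacing each edge p by its symmetric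
   difference with f0 gives a family S of subsets of X that contains set0 and
   X. The Konig property of a minor shows that, for any set P of at least two
   edges, there are edges p, q with p :|: q inside the union and p :&: q inside
   the intersection of P. Applied to {f0, a, b} and {~: f0, a, b} this gives
   p + q + r + s <= a + b + f0 + ~: f0, with equality by uniformity, so that
   {p, q, r, s} = {a, b, f0, ~: f0} by linear independence: hence S is
   cross-free. It is therefore described by a tree whose arcs are the proper
   members of S, and linear independence forces every vertex of the tree to
   carry elements of X; balance forces it to carry elements of both f0 and
   ~: f0. So every x in X has an opposite y: each edge contains exactly one of
   x and y.

   Let k be the minimum weight of a cover. An exchange argument lowers the
   weights, keeping k, until any two opposite elements have total weight k.
   Reading the weights along the tree, they are an integral combination of the
   edges, with coefficients of sum k. Each coefficient is nonnegative because it
   is either the weight of an element or the excess over k of the weight of a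
   cover with at most three elements: if no such cover existed for f0 or its
   complement, then S would contain a pattern that contracts to a pentagon,
   which violates the Konig property. *)

Set Implicit Arguments.
Unset Strict Implicit.
Unset Printing Implicit Defensive.

Import Order.TTheory GRing.Theory Num.Theory.
Local Open Scope ring_scope.

(** * Minors and the Konig property *)

Section IdealMinors.

Variables (K : fieldType) (n : nat).
Implicit Types (C D E : {set {set 'I_n}}) (Z W f g : {set 'I_n}).
Implicit Types (G H : seq {mpoly K[n]}) (p q : {mpoly K[n]}).

Lemma ideal_ofD G p q : ideal_of G p -> ideal_of G q -> ideal_of G (p + q).
Proof.
move=> [c ->] [e ->]; exists (fun i => c i + e i).
by rewrite -big_split; apply: eq_bigr => i _; rewrite mulrDl.
Qed.

Lemma ideal_ofM G p q : ideal_of G q -> ideal_of G (p * q).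
Proof.
move=> [c ->]; exists (fun i => p * c i).
by rewrite mulr_sumr; apply: eq_bigr => i _; rewrite mulrA.
Qed.

Lemma ideal_of0 G : ideal_of G 0.
Proof. by exists (fun=> 0); rewrite big1 // => i _; rewrite mul0r. Qed.

Lemma ideal_of_mem G p : p \in G -> ideal_of G p.
Proof.
move=> Gp; have ltp : (index p G < size G)%N by rewrite index_mem.
exists (fun i => (i == Ordinal ltp)%:R).
rewrite (bigD1 (Ordinal ltp)) //= eqxx mul1r nth_index // big1 ?addr0 //.
by move=> i /negPf ->; rewrite mul0r.
Qed.

Lemma ideal_of_sub G H p :
  {in G, forall q, ideal_of H q} -> ideal_of G p -> ideal_of H p.
Proof.
move=> sGH [c ->]; elim/big_ind: _ => //.
- exact: ideal_of0.
- exact: ideal_ofD.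
by move=> i _; apply: ideal_ofM; apply: sGH; apply: mem_nth.
Qed.

Lemma ideal_of_rmorph0 (S : nzRingType) (h : {rmorphism {mpoly K[n]} -> S}) G p :
  {in G, forall q, h q = 0} -> ideal_of G p -> h p = 0.
Proof.
move=> G0 [c ->]; rewrite rmorph_sum big1 // => i _.
by rewrite rmorphM /= (G0 _ (mem_nth _ (ltn_ord i))) mulr0.
Qed.

Lemma set_vars_edge_monomial Z W f :
  set_vars Z W (edge_monomial K f) =
    if [disjoint f & Z] then edge_monomial K (f :\: W) else 0.
Proof.
rewrite /set_vars /edge_monomial rmorph_prod /=.
under eq_bigr do rewrite comp_mpolyXU -tnth_nth tnth_mktuple.
case: ifPn => [dfZ | ]; last first.
  rewrite -setI_eq0 => /set0Pn[i /setIP[fi Zi]].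
  by rewrite (bigD1 i) //= Zi mul0r.
rewrite (big_setID W) /= big1 ?mul1r => [|i /setIP[fi Wi]]; last first.
  by rewrite (disjointFr dfZ fi) Wi.
apply: eq_bigr => i /setDP[fi /negPf ->].
by rewrite (disjointFr dfZ fi).
Qed.

Lemma edge_monomial_dvd f g :
  f \subset g -> edge_monomial K g = edge_monomial K (g :\: f) * edge_monomial K f.
Proof.
by move=> sfg; rewrite /edge_monomial (big_setID f) /= (setIidPr sfg) mulrC.
Qed.

(** * Combinatorial description of the minors *)

(** These are the supports of the generators that survive the substitution; the inclusion-minimal
    ones will form the clutter of the minor. *)
Definition minor_sets C Z W : {set {set 'I_n}} :=
  [set f :\: W | f in C & [disjoint f & Z]].

Definition minor_clutter C Z W : {set {set 'I_n}} :=
  [set g | minset (fun h => h \in minor_sets C Z W) g].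

Lemma minor_clutter_sub C Z W : minor_clutter C Z W \subset minor_sets C Z W.
Proof. by apply/subsetP => g; rewrite inE => /minsetp. Qed.

Lemma minor_clutter_below C Z W g :
  g \in minor_sets C Z W -> exists2 f, f \in minor_clutter C Z W & f \subset g.
Proof.
move=> Eg; have [f fmin sfg] := @minset_exists _ (fun h => h \in minor_sets C Z W) g Eg.
by exists f; rewrite ?inE.
Qed.

(** The ideal is proper because, with no empty support, every generator vanishes at the origin while
    1 does not. Minimal supports generate the same ideal, since every other surviving monomial is a
    multiple of one of theirs. *)
Lemma clutter_minorP C Z W :
    [disjoint Z & W] -> set0 \notin minor_sets C Z W ->
  clutter_minor K C (minor_clutter C Z W).
Proof.
move=> dZW E0; exists Z, W; split=> //.
- move=> I1; have /(ideal_of_rmorph0 (h := meval (fun=> 0))) : 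
    {in [seq set_vars Z W u | u <- edge_generators K C],
      forall q, meval (fun=> 0) q = 0}.
    move=> _ /mapP[_ /mapP[f + ->] ->]; rewrite mem_enum => Cf.
    rewrite set_vars_edge_monomial; case: ifPn => [dfZ|_]; last exact: meval0.
    have /set0Pn[i fi] : f :\: W != set0.
      by apply: contraNneq E0 => <-; apply/imsetP; exists f; rewrite ?inE ?Cf.
    by rewrite /edge_monomial rmorph_prod /= (bigD1 i) //= mevalXU mul0r.
  by move=> /(_ _ I1)/eqP; rewrite rmorph1 oner_eq0.
- move=> f g; rewrite !inE => /minsetp Ef gmin sfg.
  exact: minsetinf gmin Ef sfg.
move=> p; split; apply: ideal_of_sub => q.
  case/mapP=> g; rewrite mem_enum => /(subsetP (minor_clutter_sub C Z W)).
  case/imsetP=> f /setIdP[Cf dfZ] -> ->.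
  apply: ideal_of_mem; apply/mapP; exists (edge_monomial K f).
    by apply: map_f; rewrite mem_enum.
  by rewrite set_vars_edge_monomial dfZ.
case/mapP=> _ /mapP[f + ->] ->; rewrite mem_enum => Cf.
rewrite set_vars_edge_monomial; case: ifPn => [dfZ|_]; last exact: ideal_of0.
have /minor_clutter_below[g Dg sgf] : f :\: W \in minor_sets C Z W.
  by apply/imsetP; exists f; rewrite ?inE ?Cf.
rewrite (edge_monomial_dvd sgf); apply: ideal_ofM; apply: ideal_of_mem.
by apply: map_f; rewrite mem_enum.
Qed.

(** The bound [m <= n] handles [n], the default value of the minimum defining [alpha0]. *)
Lemma alpha0_ge C m : (m <= n)%N ->
  (forall S, vertex_cover C S -> (m <= #|S|)%N) -> (m <= alpha0 C)%N.
Proof.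
move=> le_mn cov_m; rewrite /alpha0; elim/big_ind: _ => //.
  by move=> x y mx my; rewrite leq_min mx.
by move=> S /minsetp; apply: cov_m.
Qed.

Lemma alpha0_attained C : set0 \notin C ->
  exists2 S, vertex_cover C S & #|S| = alpha0 C.
Proof.
move=> C0; rewrite /alpha0; elim/big_ind: _.
- exists setT; last by rewrite cardsT card_ord.
  apply/forall_inP => f Cf; rewrite setTI.
  by apply: contraNneq C0 => <-.
- move=> x y [S cS Sx] [T cT Ty].
  by rewrite /minn; case: ifP; [exists S | exists T].
by move=> S Smin; exists S => //; apply: minsetp Smin.
Qed.

Lemma beta1_attained C :
  exists M : {set {set 'I_n}}, [/\ M \subset C, trivIset M & #|M| = beta1 C].
Proof.
rewrite /beta1.
have P0 : (set0 \subset C) && trivIset (set0 : {set {set 'I_n}}).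
  by rewrite sub0set; apply/trivIsetP => A B; rewrite inE.
have /eq_bigmax_cond : (0 < #|[pred M : {set {set 'I_n}} | (M \subset C) && trivIset M]|)%N.
  by apply/card_gt0P; exists set0.
by move=> /(_ (fun M => #|M|)) [M /andP[sMC tM] ->]; exists M.
Qed.

(* Z is deleted, W is contracted, and M lifts a matching of the minor to C. *)
Lemma packing_minor C Z W m :
    packing_property K C -> [disjoint Z & W] -> (m <= n)%N ->
    (forall f, f \in C -> [disjoint f & Z] -> ~~ (f \subset W)) ->
    (forall S : {set 'I_n}, (forall f, f \in C -> [disjoint f & Z] ->
        exists2 x, x \in S & x \in f :\: W) -> (m <= #|S|)%N) ->
  exists M : {set {set 'I_n}}, [/\ (m <= #|M|)%N,
    forall f, f \in M -> f \in C /\ [disjoint f & Z]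
    & forall f g, f \in M -> g \in M -> f != g -> f :&: g \subset W].
Proof.
move=> packC dZW le_mn C0 covC.
have E0 : set0 \notin minor_sets C Z W.
  apply/imsetP=> -[f /setIdP[Cf dfZ] /esym/eqP].
  by rewrite setD_eq0; apply/negP/C0.
have konigD := packC _ (clutter_minorP dZW E0).
have [N [sND tN cardN]] := beta1_attained (minor_clutter C Z W).
have lift g : g \in N -> exists f, [&& f \in C, [disjoint f & Z] & g == f :\: W].
  move=> /(subsetP sND)/(subsetP (minor_clutter_sub C Z W))/imsetP[f].
  by case/setIdP=> Cf dfZ ->; exists f; rewrite Cf dfZ eqxx.
(* By [lift], the default [set0] is never returned on [N]. *)
pose F g := odflt set0 [pick f : {set 'I_n} | [&& f \in C, [disjoint f & Z] & g == f :\: W]].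
have FP g : g \in N -> [/\ F g \in C, [disjoint F g & Z] & F g :\: W = g].
  move/lift=> [f Pf]; rewrite /F; case: pickP => [h /and3P[? ? /eqP]|/(_ f)] //=.
  by rewrite Pf.
exists (F @: N); split.
- rewrite card_in_imset => [|g h /FP[_ _ {2}<-] /FP[_ _ {2}<-] ->] //.
  rewrite cardN -konigD; apply: alpha0_ge => // S /forall_inP covS.
  apply: covC => f Cf dfZ.
  have /minor_clutter_below[g /covS/set0Pn[x /setIP[Sx gx]] sgf] :
      f :\: W \in minor_sets C Z W by apply/imsetP; exists f; rewrite ?inE ?Cf.
  by exists x => //; apply: (subsetP sgf).
- by move=> _ /imsetP[g /FP[? ? _] ->].
move=> _ _ /imsetP[g Ng ->] /imsetP[h Nh ->] neF.
have /trivIsetP/(_ g h Ng Nh) dgh := tN.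
have /dgh : g != h by apply: contraNneq neF => ->.
have [_ _ {1}<-] := FP g Ng; have [_ _ {1}<-] := FP h Nh => dFF.
apply/subsetP => x /setIP[Fgx Fhx]; apply: contraT => Wx.
by move: (disjointFr dFF (x := x)); rewrite !inE Wx Fgx Fhx => /(_ isT).
Qed.

End IdealMinors.

(** * Cross-free families *)

Section CrossFree.

Variable T : finType.
Implicit Types (a b p q m : {set T}) (L M S : {set {set T}}).

Definition laminar L : Prop :=
  {in L &, forall a b, [|| a \subset b, b \subset a | a \subset ~: b]}.

(** Take the inclusion-maximal members: two distinct ones are not nested, hence disjoint. *)
Lemma laminar_partition L : laminar L ->
  exists M, [/\ M \subset L, trivIset M & cover M = cover L].
Proof.
move=> lamL; pose M := [set a in L | maxset (fun b => b \in L) a].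
exists M; split.
- by apply/subsetP => a /setIdP[].
- apply/trivIsetP => a b /setIdP[La amax] /setIdP[Lb bmax] neq_ab.
  rewrite disjoints_subset; case/or3P: (lamL a b La Lb) => // [sab|sba].
    by rewrite (maxsetsup amax Lb sab) eqxx in neq_ab.
  by rewrite (maxsetsup bmax La sba) eqxx in neq_ab.
apply/setP => x; apply/bigcupP/bigcupP => -[a].
  by case/setIdP=> La _ xa; exists a.
move=> La xa; have [b bmax sab] := @maxset_exists _ (fun b => b \in L) a La.
exists b; last exact: (subsetP sab).
by rewrite inE bmax (maxsetp bmax).
Qed.

(** One of the four regions cut out by the two sets is empty; this is insensitive to
    complementation. *)
Definition cross_free a b : bool :=
  [|| a \subset b, b \subset a, a \subset ~: b | ~: b \subset a].

Lemma cross_freeC a b : cross_free a (~: b) = cross_free a b.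
Proof.
rewrite /cross_free setCK.
by do !case: (_ \subset _).
Qed.

Lemma cross_free_sym a b : cross_free a b = cross_free b a.
Proof.
rewrite /cross_free (subsetC a b) (subCset b a).
by do !case: (_ \subset _).
Qed.

Definition degree (s : seq {set T}) (x : T) : nat :=
  count (fun a : {set T} => x \in a) s.

(** An integral affine relation, with its negative terms moved to the other side, is a pair of lists
    of equal length and equal degrees; lists record the multiplicities. *)
Definition affinely_independent S : Prop :=
  forall s t : seq {set T}, {subset s <= S} -> {subset t <= S} ->
  size s = size t -> degree s =1 degree t -> perm_eq s t.

Section Family.

Variable S : {set {set T}}.
Hypotheses (S0 : set0 \in S) (ST : setT \in S).
Hypothesis crossS : {in S &, forall a b, cross_free a b}.
Hypothesis indepS : affinely_independent S.

(** These are the two shores of each arc of the tree. *)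
Definition side m : bool := (m \in S) || (~: m \in S).

Lemma cross_side a b : side a -> side b -> cross_free a b.
Proof.
case/orP=> Sa /orP[]Sb; first exact: crossS.
- by rewrite -cross_freeC crossS.
- by rewrite cross_free_sym -cross_freeC crossS.
by rewrite -cross_freeC cross_free_sym -cross_freeC crossS.
Qed.

(** Otherwise [p + ~: p = set0 + setT] would be a nontrivial affine relation. *)
Lemma compl_trivial p : p \in S -> ~: p \in S -> (p == set0) || (p == setT).
Proof.
move=> Sp SpC; have : perm_eq [:: p; ~: p] [:: set0; setT].
  apply: indepS => //.
  - by apply/allP; rewrite /= Sp SpC.
  - by apply/allP; rewrite /= S0 ST.
  by move=> x; rewrite /degree /= !inE; case: (x \in p).
by move/perm_mem/(_ p); rewrite !inE eqxx /= => <-.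
Qed.

Lemma degree_trivIset M x : trivIset M -> degree (enum M) x = (x \in cover M).
Proof.
move=> tM; rewrite /degree -sum1_count big_mkcond big_enum /=.
case: (boolP (x \in cover M)) => [/bigcupP[m Mm xm]|Mx].
  rewrite (bigD1 m) //= xm big1 // => m' /andP[Mm' neq].
  have /trivIsetP/(_ m' m Mm' Mm neq) d := tM.
  by rewrite (disjointFl d xm).
rewrite big1 // => m Mm; case: ifP => // xm.
by case/bigcupP: Mx; exists m.
Qed.

Lemma degree_setC (P : pred {set T}) s x :
  (degree [seq ~: m | m <- s & ~~ P m] x + degree s x =
   degree [seq m <- s | P m] x + count (predC P) s)%N.
Proof.
rewrite /degree; elim: s => //= m s IHs.
by case: (P m) => /=; rewrite ?inE; case: (x \in m) => /=; lia.
Qed.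

(** If the sides in [L] covered exactly [p], the maximal ones would partition it, and [p] would be
    their sum: a forbidden affine relation. *)
Lemma cover_sides L p : laminar L -> {in L, forall m, side m} ->
  p \in S -> p != set0 -> p != setT -> p \notin L -> cover L != p.
Proof.
move=> lamL sideL Sp p0 pT Lp; apply/eqP => covL.
have [M [sML tM covM]] := laminar_partition lamL.
pose qs := [seq m <- enum M | m \in S].
pose rs := [seq m <- enum M | m \notin S].
(* A part [m] outside [S] enters through its complement, at the price of one [setT]; copies of
   [set0] equalize the lengths. *)
pose s := p :: [seq ~: m | m <- rs] ++ nseq (size qs) set0.
pose t := qs ++ nseq (size rs) setT ++ [:: set0].
have : perm_eq s t.
  apply: indepS.
  - move=> m; rewrite inE mem_cat mem_nseq => /or3P[/eqP->|/mapP[r]|/andP[_ /eqP->]] //.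
    rewrite mem_filter mem_enum => /andP[Sr /(subsetP sML)/sideL/orP[]].
      by rewrite (negPf Sr).
    by move=> ? ->.
  - move=> m; rewrite !mem_cat mem_nseq mem_filter inE.
    by case/or3P=> [/andP[]|/andP[_ /eqP->]|/eqP->].
  - rewrite /s /t /= !size_cat !size_nseq size_map /=; lia.
  move=> x; have := degree_setC (fun m => m \in S) (enum M) x.
  rewrite degree_trivIset // covM covL -/qs -/rs -size_filter -/rs.
  by rewrite /degree /s /t /= !count_cat !count_nseq /= !inE; lia.
move/perm_mem/(_ p); rewrite inE eqxx /= !mem_cat mem_nseq inE (negPf p0) (negPf pT).
rewrite andbF !orbF mem_filter mem_enum => /esym/andP[_].
by move/(subsetP sML); apply/negP.
Qed.

(** The tree vertex at the inner end of the arc [p] carries an element: the sides strictly inside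
    [p] are laminar, as two of them cannot cover everything, so by [cover_sides] they miss a point
    of [p]. *)
Lemma inner_vertex p : p \in S -> p != set0 -> p != setT ->
  exists2 i, i \in p & forall m, side m -> m \proper p -> i \notin m.
Proof.
move=> Sp p0 pT; pose L := [set m | side m && (m \proper p)].
have lamL : laminar L.
  move=> a b /setIdP[sa pa] /setIdP[sb pb].
  case/or4P: (cross_side sa sb) => [->|->|->|sba]; rewrite ?orbT //.
  case/negP: pT; rewrite -subTset -(setUCr b) subUset (proper_sub pb).
  exact: subset_trans sba (proper_sub pa).
have neq : cover L != p.
  apply: cover_sides => // [m /setIdP[]//|].
  by rewrite inE properxx andbF.
have sub : cover L \subset p.
  by apply/bigcupsP => m /setIdP[_ /proper_sub].
have /properP[_ [i pi Li]] : cover L \proper p by rewrite properEneq neq.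
exists i => // m sm mp; apply: contra Li => mi.
by apply/bigcupP; exists m; rewrite ?inE ?sm.
Qed.

End Family.

Lemma degree_map_setC s x : (degree [seq ~: a | a <- s] x + degree s x = size s)%N.
Proof. by rewrite /degree; elim: s => //= a s IHs; rewrite inE; case: (x \in a) => /=; lia. Qed.

Lemma affinely_independent_setC S :
  affinely_independent S -> affinely_independent [set ~: a | a in S].
Proof.
move=> indep s t sS tS size_st deg_st.
have subC u : {subset u <= [set ~: a | a in S]} -> {subset [seq ~: a | a <- u] <= S}.
  by move=> uS _ /mapP[_ /uS/imsetP[a Sa ->] ->]; rewrite setCK.
have CK : cancel (map (fun a => ~: a)) (map (fun a : {set T} => ~: a)).
  by move=> u; rewrite -map_comp map_id_in // => a _; rewrite /= setCK.
rewrite -(CK s) -(CK t); apply/perm_map/indep; rewrite ?size_map //; try exact: subC.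
by move=> x; have := degree_map_setC s x; have := degree_map_setC t x;
   have := deg_st x; lia.
Qed.

Lemma cross_free_setC S : {in S &, forall a b, cross_free a b} ->
  {in [set ~: a | a in S] &, forall a b, cross_free a b}.
Proof.
move=> crossS _ _ /imsetP[a Sa ->] /imsetP[b Sb ->].
by rewrite cross_freeC cross_free_sym cross_freeC; apply: crossS.
Qed.

Lemma setC_mem S p : (p \in [set ~: a | a in S]) = (~: p \in S).
Proof. by rewrite -{1}(setCK p) mem_imset //; apply: setC_inj. Qed.

(** * The tree of an affinely independent cross-free family *)

Section Tree.

Variable S : {set {set T}}.
Hypotheses (S0 : set0 \in S) (ST : setT \in S).
Hypothesis crossS : {in S &, forall a b, cross_free a b}.
Hypothesis indepS : affinely_independent S.

(** Complementing every member exchanges the two ends of an arc and reduces this to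
    [inner_vertex]. *)
Lemma outer_vertex p : p \in S -> p != set0 -> p != setT ->
  exists2 j, j \notin p & forall m, side S m -> p \proper m -> j \in m.
Proof.
move=> Sp p0 pT; have [] := @inner_vertex [set ~: a | a in S] _ _ _ _ (~: p).
- by rewrite setC_mem setC0.
- by rewrite setC_mem setCT.
- exact: cross_free_setC.
- exact: affinely_independent_setC.
- by rewrite setC_mem setCK.
- by rewrite -setCT (inj_eq (@setC_inj T)).
- by rewrite -setC0 (inj_eq (@setC_inj T)).
move=> j; rewrite inE => pj inner; exists j => // m sm pm.
have := inner (~: m); rewrite inE negbK; apply.
  by move: sm; rewrite /side !setC_mem setCK orbC.
by rewrite properE setCS setCS -properE.
Qed.

(** Take [i] and [j] at the two ends of the arc [p]. A path from [i'] in [p] to [j'] outside passes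
    through [i], then [p], then [j], so whatever separates [i] from [i'], or [j] from [j'], also
    separates [i'] from [j']. *)
Lemma separated_once p : p \in S -> p != set0 -> p != setT ->
  exists i j, [/\ i \in p, j \notin p,
    forall q, q \in S -> q != p -> (i \in q) = (j \in q),
    forall q i' j', q \in S -> i' \in p -> j' \notin p ->
      (i \in q) != (i' \in q) -> (i' \in q) != (j' \in q)
    & forall q i' j', q \in S -> i' \in p -> j' \notin p ->
      (j \in q) != (j' \in q) -> (i' \in q) != (j' \in q)].
Proof.
move=> Sp p0 pT.
have [i pi inn] := inner_vertex S0 ST crossS indepS Sp p0 pT.
have [j pj out] := outer_vertex Sp p0 pT.
have sideq q : q \in S -> side S q by rewrite /side => ->.
have sideCq q : q \in S -> side S (~: q) by rewrite /side setCK orbC => ->.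
have neqC q : q \in S -> ~: q != p.
  move=> Sq; apply: contraNneq p0 => ep; subst p.
  have /orP[/eqP q0|/eqP ->] := compl_trivial S0 ST indepS Sq Sp.
    by rewrite q0 setC0 eqxx in pT.
  by rewrite setCT.
have inS q : q \in S -> q != p -> q \subset p -> i \notin q.
  by move=> Sq neq sub; apply: inn (sideq q Sq) _; rewrite properEneq neq.
have inCS q : q \in S -> ~: p \subset q -> i \in q.
  move=> Sq sub; have := inn _ (sideCq q Sq); rewrite inE negbK; apply.
  by rewrite properEneq (neqC q Sq) subCset.
have outS q : q \in S -> q != p -> p \subset q -> j \in q.
  by move=> Sq neq sub; apply: out (sideq q Sq) _; rewrite properEneq eq_sym neq.
have outCS q : q \in S -> q \subset ~: p -> j \notin q.
  move=> Sq sub; have := out _ (sideCq q Sq); rewrite inE; apply.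
  by rewrite properEneq eq_sym (neqC q Sq) subsetC.
have memC x q : q \subset ~: p -> x \in p -> x \notin q.
  by move=> sub xp; apply: contraL xp => /(subsetP sub); rewrite inE.
have memCN x q : ~: p \subset q -> x \notin p -> x \in q.
  by move=> sub xp; apply: (subsetP sub); rewrite inE.
have memS x q : q \subset p -> x \notin p -> x \notin q.
  by move=> sub; apply: contra; apply: (subsetP sub).
have memN x q : p \subset q -> x \in p -> x \in q.
  by move=> sub; apply: (subsetP sub).
have crossp q : q \in S ->
    [\/ q \subset p, p \subset q, q \subset ~: p | ~: p \subset q].
  by move=> Sq; apply/or4P/crossS.
exists i, j; split=> //.
- move=> q Sq neq; case: (crossp q Sq) => sub.
  + by rewrite (negPf (inS q Sq neq sub)) (negPf (memS j q sub pj)).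
  + by rewrite (memN i q sub pi) outS.
  + by rewrite (negPf (memC i q sub pi)) (negPf (outCS q Sq sub)).
  by rewrite inCS // (memCN j q sub pj).
- move=> q i' j' Sq pi' pj'; have [->|neq] := eqVneq q p.
    by rewrite pi pi'.
  case: (crossp q Sq) => sub.
  + by rewrite (negPf (inS q Sq neq sub)) (negPf (memS j' q sub pj')); case: (i' \in q).
  + by rewrite (memN i q sub pi) (memN i' q sub pi').
  + by rewrite (negPf (memC i q sub pi)) (negPf (memC i' q sub pi')).
  by rewrite inCS // (memCN j' q sub pj'); case: (i' \in q).
move=> q i' j' Sq pi' pj'; have [->|neq] := eqVneq q p.
  by rewrite (negPf pj) (negPf pj').
case: (crossp q Sq) => sub.
- by rewrite (negPf (memS j q sub pj)) (negPf (memS j' q sub pj')).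
- by rewrite outS // (memN i' q sub pi'); case: (i' \in q).
- by rewrite (negPf (outCS q Sq sub)) (negPf (memC i' q sub pi')); case: (i' \in q).
by rewrite (memCN j q sub pj) (memCN j' q sub pj').
Qed.

(** The induction is on the number of members separating [i] from [j], that is, on their distance in
    the tree. *)
Lemma constant_of_separated (f : T -> int) :
    (forall i j, {in S, forall q, (i \in q) = (j \in q)} -> f i = f j) ->
    (forall p i j, p \in S -> i \in p -> j \notin p ->
      (forall q, q \in S -> q != p -> (i \in q) = (j \in q)) -> f i = f j) ->
  forall i j, f i = f j.
Proof.
move=> twin once i j; pose sep (k l : T) := [set q in S | (k \in q) != (l \in q)].
have [m] := ubnP #|sep i j|; elim: m i j => // m IHm i j; rewrite ltnS => le_m.
have [sep0|/set0Pn[p /setIdP[Sp]]] := eqVneq (sep i j) set0.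
  apply: twin => q Sq; have := in_set0 q; rewrite -sep0 inE Sq /=.
  by move/negbFE/eqP.
wlog [pi pj] : i j le_m / i \in p /\ j \notin p.
  move=> IH; case pi: (i \in p); case pj: (j \in p) => //= _.
    by apply: (IH i j le_m); rewrite ?pi ?pj.
  symmetry; apply: (IH j i); rewrite ?pi ?pj //.
  suff -> : sep j i = sep i j by [].
  by apply/setP => q; rewrite !inE eq_sym.
move=> _; have p0 : p != set0 by apply: contraTneq pi => ->; rewrite inE.
have pT : p != setT by apply: contraNneq pj => ->; rewrite inE.
(* The path is cut at the arc [p]; neither remaining piece crosses [p], so both are shorter. *)
have [i' [j' [pi' pj' ij' sepi sepj]]] := separated_once Sp p0 pT.
have drop k l : k \in p -> l \notin p -> forall u v, sep u v \subset sep k l ->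
  p \notin sep u v -> p \in sep k l -> (#|sep u v| < #|sep k l|)%N.
  move=> _ _ u v sub Np Yp; apply: proper_card; rewrite properE sub /=.
  by apply/negP => /subsetP/(_ p Yp); apply/negP.
have Yp : p \in sep i j by rewrite inE Sp pi (negPf pj).
transitivity (f i').
  symmetry; apply: IHm; apply: leq_trans le_m; apply: (drop i j) => //.
    apply/subsetP => q /setIdP[Sq neq]; rewrite inE Sq /=.
    exact: sepi Sq pi pj neq.
  by rewrite inE pi pi' eqxx andbF.
transitivity (f j'); first exact: (once p).
apply: IHm; apply: leq_trans le_m; apply: (drop i j) => //.
  apply/subsetP => q /setIdP[Sq neq]; rewrite inE Sq /=.
  exact: sepj Sq pi pj neq.
by rewrite inE (negPf pj) (negPf pj') eqxx andbF.
Qed.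

(** The coefficient of a proper member is the jump of [f] across its arc. After subtracting these
    jumps a constant remains, which becomes the coefficient of [setT]. *)
Lemma affine_span (f : T -> int) (k : int) :
    (forall i j, {in S, forall q, (i \in q) = (j \in q)} -> f i = f j) ->
    set0 != setT :> {set T} ->
  exists z : {set T} -> int, \sum_(p in S) z p = k /\
    forall x, f x = \sum_(p in S) z p *+ (x \in p).
Proof.
move=> twin T0.
have /fin_all_exists[z zP] : forall p : {set T}, exists z : int,
    forall i j, p \in S -> i \in p -> j \notin p ->
      (forall q, q \in S -> q != p -> (i \in q) = (j \in q)) -> z = f i - f j.
  move=> p; case: (boolP [&& p \in S, p != set0 & p != setT]); last first.
    rewrite !negb_and !negbK => /or3P[/negPf nS|/eqP p0|/eqP pT]; exists 0 => i j.
    - by rewrite nS.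
    - by rewrite p0 inE.
    by rewrite pT !inE.
  case/and3P=> Sp p0 pT.
  have [i' [j' [pi' pj' ij' sepi sepj]]] := separated_once Sp p0 pT.
  exists (f i' - f j') => i j _ pi pj ij; congr (_ - _); apply: twin => q Sq.
    apply/eqP; apply: contraT => neq; have := sepi q i j Sq pi pj neq.
    have [eqp|neqp] := eqVneq q p; last by rewrite ij // eqxx.
    by rewrite eqp pi pi' in neq.
  apply/eqP; apply: contraT => neq; have := sepj q i j Sq pi pj neq.
  have [eqp|neqp] := eqVneq q p; last by rewrite ij // eqxx.
  by rewrite eqp (negPf pj) (negPf pj') in neq.
pose F := [pred p in S | (p != set0) && (p != setT)].
pose e x := f x - \sum_(p in F) z p *+ (x \in p).
have splitS (g : {set T} -> int) :
    \sum_(p in S) g p = g set0 + (g setT + \sum_(p in F) g p).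
  rewrite (bigD1 set0) //= (bigD1 setT) /=; last by rewrite ST eq_sym.
  by congr (_ + (_ + _)); apply: eq_bigl => p; rewrite !inE andbA.
have e_cst : forall i j, e i = e j.
  apply: constant_of_separated => [i j ij | p i j Sp pi pj ij].
    rewrite /e (twin i j) //; congr (_ - _); apply: eq_bigr => p /andP[Sp _].
    by rewrite ij.
  have p0 : p != set0 by apply: contraTneq pi => ->; rewrite inE.
  have pT : p != setT by apply: contraNneq pj => ->; rewrite inE.
  have Fp : F p by rewrite /F /= Sp p0 pT.
  rewrite /e (bigD1 p) //= pi [in RHS](bigD1 p) //= (negPf pj) mulr0n add0r mulr1n.
  rewrite (zP p i j Sp pi pj ij) opprD addrA opprB addrCA subrr addr0.
  congr (_ - _); apply: eq_bigr => q /andP[/andP[Sq _] neq].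
  by rewrite ij.
have [x0 _] : exists x0 : T, x0 \in setT.
  by apply/set0Pn; rewrite eq_sym.
(* The coefficient of [set0] affects no value of [f], so it is free to adjust the total to [k]. *)
pose g p := if p == setT then e x0 else
  if p == set0 then k - e x0 - \sum_(p in F) z p else z p.
have gF p : F p -> g p = z p.
  by case/and3P=> _ /negPf p0 /negPf pT; rewrite /g p0 pT.
exists g; split.
  rewrite splitS (eq_bigr z) // /g (negPf T0) !eqxx.
  by rewrite [e x0 + _]addrC addrA !subrK.
move=> x; rewrite (splitS (fun p => g p *+ (x \in p))) !inE mulr0n mulr1n add0r.
rewrite (eq_bigr (fun p => z p *+ (x \in p))) => [|p /gF-> //].
by rewrite /g eqxx (e_cst x0 x) /e subrK.
Qed.

(** * Isolating the empty set by few elements *)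

Definition proper_sets : {set {set T}} := S :\: [set set0; setT].

Lemma proper_setsP p :
  reflect [/\ p \in S, p != set0 & p != setT] (p \in proper_sets).
Proof. by rewrite !inE negb_or andbC; apply: (iffP and3P). Qed.

(** The complements of the proper members form a laminar family. If they covered everything, its
    maximal members [m] would satisfy [setT] plus the sum of the [~: m] equals [set0] plus as many
    copies of [setT] as there are [m]. *)
Lemma common_vertex (x0 : T) :
    {in proper_sets &, forall p q, ~~ (p \subset ~: q)} ->
  exists i, {in proper_sets, forall p, i \in p}.
Proof.
move=> meet; pose L := [set ~: p | p in proper_sets].
have lamL : laminar L.
  move=> _ _ /imsetP[p Fp ->] /imsetP[q Fq ->].
  have [Sp _ _] := proper_setsP _ Fp; have [Sq _ _] := proper_setsP _ Fq.
  rewrite !setCS; case/or4P: (crossS Sp Sq) => [->|->|sub|->]; rewrite ?orbT //.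
  by case/negP: (meet p q Fp Fq).
have [M [sML tM covM]] := laminar_partition lamL.
suff /subsetPn[i _ Li] : ~~ ([set: T] \subset cover L).
  exists i => p Fp; apply: contraR Li => ip; apply/bigcupP.
  by exists (~: p); rewrite ?inE ?imset_f.
apply/negP; rewrite subTset -covM => /eqP covT.
have FM m : m \in M -> ~: m \in proper_sets.
  by move/(subsetP sML)/imsetP=> [p Fp ->]; rewrite setCK.
have SM m : m \in M -> ~: m \in S by case/FM/proper_setsP.
have : perm_eq (setT :: [seq ~: m | m <- enum M]) (set0 :: nseq (size (enum M)) setT).
  apply: indepS.
  - by move=> m; rewrite inE => /orP[/eqP->//|/mapP[r]]; rewrite mem_enum => /SM + ->.
  - by move=> m; rewrite inE mem_nseq => /orP[/eqP->//|/andP[_ /eqP->]].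
  - by rewrite /= size_map size_nseq.
  move=> x; have := degree_map_setC (enum M) x.
  rewrite degree_trivIset // covT /degree /= count_nseq !inE; lia.
have /bigcupP[m Mm _] : x0 \in cover M by rewrite covT.
move/perm_mem/(_ (~: m)); rewrite !inE map_f ?mem_enum // orbT mem_nseq.
by have /proper_setsP[_ /negPf-> /negPf->] := FM m Mm; rewrite andbF.
Qed.

(** The signs are chosen so that, once read on actual edges, the five patterns of [five_hole] are
    the edges of a pentagon. *)
Definition parity_vector (i s c t l : T) (p : {set T}) : seq bool :=
  [:: i \notin p; s \in p; c \notin p; t \in p; l \notin p].

Definition five_hole (i s c t l : T) : Prop :=
  {in S, forall p, (2 <= count id (parity_vector i s c t l p))%N} /\
  (forall v, v \in [:: [:: true; false; false; true; false];
                       [:: true; false; true; false; false];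
                       [:: false; false; true; false; true];
                       [:: false; true; false; false; true];
                       [:: false; true; false; true; false]] ->
    exists2 p, p \in S & parity_vector i s c t l p = v).

(** If no two proper members are disjoint, a common element singles out [set0]. Otherwise a smallest
    disjoint pair [q], [r] organizes the family, and the largest members [a] and [b] avoiding [l] in
    [r] and [i] in [q] decide: disjoint, they yield three elements; covering everything, they yield
    a pentagon. *)
Lemma empty_set_certificate (x0 : T) :
    (forall a b c, a \in proper_sets -> b \in proper_sets -> c \in proper_sets ->
      a \subset ~: b -> a \subset ~: c -> b \subset ~: c -> False) ->
  [\/ exists i : T, forall p, p \in S -> (i \in p) = (p != set0),
      exists i j l : T, forall p, p \in S ->
        ((j \in p) + (i \notin p) + (l \notin p) = (p == set0).+1)%N
    | exists i s c t l : T, five_hole i s c t l].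
Proof.
move=> no3.
have [/existsP[[q0 r0] /= P0] | disj0] := boolP [exists u : {set T} * {set T},
    [&& u.1 \in proper_sets, u.2 \in proper_sets & u.1 \subset ~: u.2]]; last first.
  have [p q Fp Fq | i iF] := common_vertex x0.
    by apply: contra disj0 => sub; apply/existsP; exists (p, q); rewrite /= Fp Fq.
  constructor 1; exists i => p Sp; have [->|p0] := eqVneq; first by rewrite inE.
  have [->|pT] := eqVneq p setT; first by rewrite inE.
  exact/iF/proper_setsP.
pose P (u : {set T} * {set T}) := 
  [&& u.1 \in proper_sets, u.2 \in proper_sets & u.1 \subset ~: u.2].
have {P0} P0 : P (q0, r0) by [].
(* Minimal total size makes both [q] and [r] minimal proper members. *)
case: (arg_minnP (fun u : {set T} * {set T} => #|u.1| + #|u.2|)%N P0) => -[q r].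
case/and3P=> /= Fq Fr qr min_qr {P0}.
have minq p : p \in proper_sets -> p \subset q -> p = q.
  move=> Fp sub; apply/eqP; rewrite eqEcard sub /= -(leq_add2r #|r|).
  by apply: (min_qr (p, r)); rewrite /P /= Fp Fr (subset_trans sub).
have minr p : p \in proper_sets -> p \subset r -> p = r.
  move=> Fp sub; apply/eqP; rewrite eqEcard sub /= -(leq_add2l #|q|).
  apply: (min_qr (q, p)); rewrite /P /= Fp Fq (subset_trans qr) //.
  by rewrite setCS.
have rq : r \subset ~: q by rewrite subsetC.
have [Sq q0' qT] := proper_setsP _ Fq; have [Sr r0' rT] := proper_setsP _ Fr.
(* A member containing neither would be disjoint from both, against [no3]. *)
have cont p : p \in proper_sets -> (q \subset p) || (r \subset p).
  move=> Fp; have [Sp p0 pT] := proper_setsP _ Fp.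
  case/or4P: (crossS Sp Sq) => [/(minq p Fp)->|->|pq|qp]; rewrite ?subxx //.
    case/or4P: (crossS Sp Sr) => [/(minr p Fp)->|->|pr|rp]; rewrite ?subxx ?orbT //.
      by case: (no3 p q r).
    by rewrite (subset_trans qr rp).
  by rewrite (subset_trans rq qp) orbT.
have [i qi inn_i] := inner_vertex S0 ST crossS indepS Sq q0' qT.
have [l rl inn_l] := inner_vertex S0 ST crossS indepS Sr r0' rT.
have sideq p : p \in S -> side S p by rewrite /side => ->.
have sideCq p : p \in S -> side S (~: p) by rewrite /side setCK orbC => ->.
have neqC p p' : p \in S -> p' \in proper_sets -> ~: p != p'.
  move=> Sp Fp'; apply/eqP => ep; subst p'; have [SpC p0 pT] := proper_setsP _ Fp'.
  by have := compl_trivial S0 ST indepS SpC; rewrite setCK (negPf p0) (negPf pT) => /(_ Sp).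
(* The roles of [q] and [r] are parameters, as this is used for both. *)
have avoid (q' r' : {set T}) (i' : T) : q' \in proper_sets -> 
    (forall p, p \in proper_sets -> p \subset q' -> p = q') ->
    (forall p, p \in proper_sets -> (q' \subset p) || (r' \subset p)) ->
    i' \in q' -> (forall m, side S m -> m \proper q' -> i' \notin m) ->
    forall p, p \in proper_sets -> i' \notin p -> (p \subset ~: q') && (r' \subset p).
  move=> Fq' minq' cont' qi' inn' p Fp ip; have [Sp p0 pT] := proper_setsP _ Fp.
  have [Sq' _ _] := proper_setsP _ Fq'.
  have qp : ~~ (q' \subset p) by apply: contra ip => /subsetP; apply.
  have := cont' p Fp; rewrite (negPf qp) /= => ->; rewrite andbT.
  case/or4P: (crossS Sp Sq') => [/(minq' p Fp) eqp|qp'||sub] //.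
  - by rewrite eqp qi' in ip.
  - by rewrite qp' in qp.
  have := inn' _ (sideCq p Sp); rewrite properEneq (neqC p q' Sp Fq').
  by rewrite subCset sub inE ip => /(_ isT).
have avoid_i := avoid q r i Fq minq cont qi inn_i.
have cont' p : p \in proper_sets -> (r \subset p) || (q \subset p).
  by move=> Fp; rewrite orbC cont.
have avoid_l := avoid r q l Fr minr cont' rl inn_l.
have li_q : l \notin q by apply: contraL rl => /(subsetP qr); rewrite inE.
have il_r : i \notin r by apply: contraL qi => /(subsetP rq); rewrite inE.
(* The members missing [l'] contain [q'] and avoid [r'], so two of them are neither disjoint nor
   covering: they form a chain, and the largest contains all the others. *)
have maxchain (q' r' : {set T}) (l' : T) : q' \in proper_sets -> l' \notin q' -> q' != set0 ->
    r' != set0 ->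
    (forall p, p \in proper_sets -> l' \notin p -> (p \subset ~: r') && (q' \subset p)) ->
    exists a, [/\ a \in proper_sets, l' \notin a &
      forall p, p \in proper_sets -> l' \notin p -> p \subset a].
  move=> Fq' lq' q0'' r0'' avoid'.
  have Pq : (q' \in proper_sets) && (l' \notin q') by rewrite Fq'.
  case: (@arg_maxnP _ q' (fun p => (p \in proper_sets) && (l' \notin p))
           (fun p => #|p|) Pq) => a /andP[Fa la] maxa.
  exists a; split=> // p Fp lp; have := maxa p; rewrite Fp lp => /(_ isT) cpa.
  have [Sp _ _] := proper_setsP _ Fp; have [Sa _ _] := proper_setsP _ Fa.
  have /andP[par qa] := avoid' a Fa la; have /andP[ppr qp] := avoid' p Fp lp.
  have [x qx] := set0Pn _ q0''; have [y ry] := set0Pn _ r0''.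
  case/or4P: (crossS Sp Sa) => // [ap|dis|cov].
  - by have /eqP-> : a == p by rewrite eqEcard ap.
  - have := subsetP dis x (subsetP qp x qx).
    by rewrite inE (subsetP qa x qx).
  have := subsetP ppr y; rewrite inE ry.
  have -> : y \in p; last by move=> /(_ isT).
  apply: (subsetP cov); rewrite inE; apply: contraL ry => /(subsetP par).
  by rewrite inE.
have [a [Fa la maxa]] := maxchain q r l Fq li_q q0' r0' avoid_l.
have [b [Fb ib maxb]] := maxchain r q i Fr il_r r0' q0' avoid_i.
have /andP[ar qa] := avoid_l a Fa la; have /andP[bq rb] := avoid_i b Fb ib.
have [Sa a0 aT] := proper_setsP _ Fa; have [Sb b0 bT] := proper_setsP _ Fb.
have [j ja out_j] := outer_vertex Sa a0 aT.
have [s sb out_s] := outer_vertex Sb b0 bT.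
have ia : i \in a by apply: (subsetP qa).
have lb : l \in b by apply: (subsetP rb).
have both_j p : p \in S -> i \in p -> l \in p -> j \in p.
  move=> Sp ip lp; case/or4P: (crossS Sp Sa) => [pa|ap|pa|ap].
  - by rewrite (subsetP pa l lp) in la.
  - apply: out_j (sideq p Sp) _; rewrite properEneq ap andbT.
    by apply: contraNneq la => ->.
  - by have := subsetP pa i ip; rewrite inE ia.
  by apply: (subsetP ap); rewrite inE.
have both_s p : p \in S -> i \in p -> l \in p -> s \in p.
  move=> Sp ip lp; case/or4P: (crossS Sp Sb) => [pb|bp|pb|bp].
  - by rewrite (subsetP pb i ip) in ib.
  - apply: out_s (sideq p Sp) _; rewrite properEneq bp andbT.
    by apply: contraNneq ib => ->.
  - by have := subsetP pb l lp; rewrite inE lb.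
  by apply: (subsetP bp); rewrite inE.
have one_of p : p \in proper_sets -> i \notin p -> l \in p.
  by move=> Fp /(avoid_i p Fp)/andP[_ /subsetP]; apply.
(* Neither set contains the other, because [i] lies in [a] only and [l] in [b] only. *)
case/or4P: (crossS Sa Sb) => [ab|ba|ab|ab].
- by rewrite (subsetP ab i ia) in ib.
- by rewrite (subsetP ba l lb) in la.
- constructor 2; exists i, j, l => p Sp.
  have [->|p0] := eqVneq p set0; first by rewrite !inE.
  have [->|pT] := eqVneq p setT; first by rewrite !inE.
  have Fp : p \in proper_sets by apply/proper_setsP.
  have [lp|lp] := boolP (l \in p); last first.
    have [ip|/(one_of p Fp)] := boolP (i \in p); last by rewrite (negPf lp).
    by rewrite (contraNF (subsetP (maxa p Fp lp) j) ja).
  have [ip|ip] := boolP (i \in p); first by rewrite both_j.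
  have pb := maxb p Fp ip.
  suff /negPf-> : j \notin p by [].
  have := out_j _ (sideCq p Sp); rewrite inE; apply.
  rewrite properEneq eq_sym (neqC p a Sp Fa) subsetC.
  by rewrite (subset_trans pb) // subsetC.
(* If [a] and [b] did not meet they would be complementary, which [compl_trivial] forbids. *)
have [c ca cb] : exists2 c, c \in a & c \in b.
  apply/exists_inP; apply: contraT; rewrite negb_exists_in => /forall_inP dis.
  have := compl_trivial S0 ST indepS Sb; rewrite (negPf b0) (negPf bT).
  suff -> : ~: b = a by move/(_ Sa).
  apply/eqP; rewrite eqEsubset ab; apply/subsetP => x /dis.
  by rewrite inE.
have sa : s \in a by apply: (subsetP ab); rewrite inE.
have jb : j \in b by apply: contraR ja => jb; apply: (subsetP ab); rewrite inE.
have jr : j \notin r.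
  have := out_j _ (sideCq r Sr); rewrite inE; apply.
  by rewrite properEneq eq_sym (neqC r a Sr Fa) ar.
have sq : s \notin q.
  have := out_s _ (sideCq q Sq); rewrite inE; apply.
  by rewrite properEneq eq_sym (neqC q b Sq Fb) bq.
have sr : s \notin r by apply: contra sb; apply: (subsetP rb).
have jq : j \notin q by apply: contra ja; apply: (subsetP qa).
have cr : c \notin r by apply: contraL ca => cr; apply: contraL cr => /(subsetP ar); rewrite inE.
have cq : c \notin q by apply: contraL cb => cq; apply: contraL cq => /(subsetP bq); rewrite inE.
constructor 3; exists i, s, c, j, l; split.
  move=> p Sp; rewrite /parity_vector /=.
  have [->|p0] := eqVneq p set0; first by rewrite !inE.
  have [->|pT] := eqVneq p setT; first by rewrite !inE.
  have Fp : p \in proper_sets by apply/proper_setsP.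
  have [ip|ip] := boolP (i \in p); have [lp|lp] := boolP (l \in p).
  - by rewrite both_j ?both_s //; case: (c \in p).
  - have [cp|//] := boolP (c \in p); last by case: (s \in p); case: (j \in p).
    suff -> : s \in p by case: (j \in p).
    case/or4P: (crossS Sp Sb) => [pb|bp|pb|pb].
    + by rewrite (subsetP pb i ip) in ib.
    + by rewrite (subsetP bp l lb) in lp.
    + by have := subsetP pb c cp; rewrite inE cb.
    by apply: (subsetP pb); rewrite inE.
  - have [cp|//] := boolP (c \in p); last by case: (s \in p); case: (j \in p).
    suff -> : j \in p by case: (s \in p).
    case/or4P: (crossS Sp Sa) => [pa|ap|pa|pa].
    + by rewrite (subsetP pa l lp) in la.
    + by rewrite (subsetP ap i ia) in ip.
    + by have := subsetP pa c cp; rewrite inE ca.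
    by apply: (subsetP pa); rewrite inE.
  by rewrite one_of in lp.
(* The five patterns are realized by [b], [r], [q], [a] and [setT]; [j] plays the part of [t]. *)
move=> v; rewrite !inE => /or4P[/eqP->|/eqP->|/eqP->|/orP[]/eqP->].
- by exists b; rewrite // /parity_vector ib (negPf sb) cb jb lb.
- by exists r; rewrite // /parity_vector il_r (negPf sr) cr (negPf jr) rl.
- by exists q; rewrite // /parity_vector qi (negPf sq) cq (negPf jq) li_q.
- by exists a; rewrite // /parity_vector ia sa ca (negPf ja) la.
by exists setT; rewrite // /parity_vector !inE.
Qed.

End Tree.
End CrossFree.

(** * The tree structure of the edges *)

Section ComplementaryEdges.

Variables (K : fieldType) (n d : nat) (C : {set {set 'I_n}}).
Hypothesis packC : packing_property K C.
Hypothesis unifC : uniform d C.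
Hypothesis indepC : forall s t : seq {set 'I_n}, {subset s <= C} ->
  {subset t <= C} -> degree s =1 degree t -> perm_eq s t.
Hypothesis n_gt1 : (1 < n)%N.

Implicit Types (p q a b f : {set 'I_n}) (P : {set {set 'I_n}}).

Lemma leq_b2b (u v : bool) : (u -> v) -> (u <= v)%N.
Proof. by case: u; case: v => // /(_ isT). Qed.

(** Delete the vertices outside the union of [P] and contract its intersection. By uniformity no
    edge lies inside the intersection. A single vertex cannot cover the minor, for it would belong
    to every member of [P] and so be contracted; hence the minor has two disjoint edges. *)
Lemma polarity P : P \subset C -> (1 < #|P|)%N ->
  exists p q, [/\ p \in C, q \in C & forall x, ((x \in p) + (x \in q) <=
    (x \in cover P) + [forall f in P, x \in f])%N].
Proof.
move=> sPC /card_gt1P[a [b [Pa Pb neq_ab]]].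
pose W := [set x | [forall f in P, x \in f]].
have memW x f : x \in W -> f \in P -> x \in f.
  by rewrite inE => /forall_inP; apply.
have dW : [disjoint ~: cover P & W].
  rewrite disjoints_subset setCS; apply/subsetP => x Wx.
  by apply/bigcupP; exists a => //; apply: memW.
have [f Cf _|S covS|M [M2 MP MI]] := packing_minor packC dW n_gt1.
- apply/negP => /subsetP fW; case/eqP: neq_ab.
  have eqf g : g \in P -> f = g.
    move=> Pg; apply/eqP; rewrite eqEcard (unifC Cf) (unifC (subsetP sPC g Pg)) leqnn andbT.
    by apply/subsetP => x /fW/memW; apply.
  by rewrite -(eqf a) // (eqf b).
- have hit g : g \in P -> exists2 x, x \in S & x \in g :\: W.
    move=> Pg; apply: covS; first exact: (subsetP sPC).
    rewrite disjoints_subset setCK; exact: bigcup_sup.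
  rewrite leqNgt ltnS; apply/negP => /card_le1_eqP S1.
  have [x Sx /setDP[_ /negP[]]] := hit a Pa.
  rewrite inE; apply/forall_inP => g /hit[y Sy /setDP[gy _]].
  by rewrite (S1 y x).
have /card_gt1P[p [q [Mp Mq neq]]] := M2.
have [Cp dp] := MP p Mp; have [Cq dq] := MP q Mq.
exists p, q; split=> // x.
have pP : x \in p -> x \in cover P.
  by apply/subsetP; rewrite -(setCK (cover P)) -disjoints_subset.
have qP : x \in q -> x \in cover P.
  by apply/subsetP; rewrite -(setCK (cover P)) -disjoints_subset.
have pqW : x \in p -> x \in q -> [forall f in P, x \in f].
  by move=> xp xq; have := subsetP (MI p q Mp Mq neq) x; rewrite !inE xp xq; apply.
case: (x \in p) pP pqW => [/(_ isT)-> /(_ isT)|_ _]; case: (x \in q) qP => //.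
- by move=> _ /(_ isT)->.
- by move=> /(_ isT)->.
Qed.

Section Star.

Variable f0 : {set 'I_n}.
Hypotheses (Cf0 : f0 \in C) (Cf0C : ~: f0 \in C).

(* Measured against f0, the incidence relation becomes monotone: f0 is sent to
   the empty set, its complement to the full set. *)
Definition star p : {set 'I_n} := [set x | (x \in p) (+) (x \in f0)].

Lemma starK : involutive star.
Proof. by move=> p; apply/setP => x; rewrite !inE -addbA addbb addbF. Qed.

Definition stars : {set {set 'I_n}} := [set star p | p in C].

Lemma mem_stars p : (star p \in stars) = (p \in C).
Proof. by rewrite mem_imset //; apply: inv_inj starK. Qed.

Lemma starP a : a \in stars -> exists2 p, p \in C & a = star p.
Proof. by case/imsetP=> p; exists p. Qed.

Lemma star0 : star f0 = set0.
Proof. by apply/setP => x; rewrite !inE addbb. Qed.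

Lemma starT : star (~: f0) = setT.
Proof. by apply/setP => x; rewrite !inE addNb addbb. Qed.

Lemma star_eq0 p : (star p == set0) = (p == f0).
Proof. by rewrite -star0 (inj_eq (inv_inj starK)). Qed.

Lemma star_eqT p : (star p == setT) = (p == ~: f0).
Proof. by rewrite -starT (inj_eq (inv_inj starK)). Qed.

Lemma stars0 : set0 \in stars.
Proof. by rewrite -star0 mem_stars. Qed.

Lemma starsT : setT \in stars.
Proof. by rewrite -starT mem_stars. Qed.

Lemma degree_star s x :
  degree [seq star p | p <- s] x =
    if x \in f0 then (size s - degree s x)%N else degree s x.
Proof.
have le_deg u : (degree u x <= size u)%N by exact: count_size.
rewrite /degree; elim: s => /= [|p s]; first by rewrite if_same.
have := le_deg s; rewrite /degree inE.
by case: ifP => _; case: (x \in p) => /=; lia.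
Qed.

(** On [f0], [star] turns a degree into the size minus that degree, so degrees transfer between
    lists of equal size only: linear independence of the edges becomes affine independence of the
    stars. *)
Lemma stars_independent : affinely_independent stars.
Proof.
move=> s t sS tS size_st deg_st.
have starKs : cancel (map star) (map star).
  by move=> u; rewrite -map_comp map_id_in // => a _; apply: starK.
have subC u : {subset u <= stars} -> {subset map star u <= C}.
  by move=> uS _ /mapP[_ /uS/starP[p Cp ->] ->]; rewrite starK.
rewrite -(starKs s) -(starKs t); apply/perm_map/indepC; try exact: subC.
by move=> x; rewrite !degree_star size_st deg_st.
Qed.

Lemma sum_degree s : {subset s <= C} -> (\sum_x degree s x = size s * d)%N.
Proof.
elim: s => [_|p s IHs sC] /=; first by rewrite big1.
rewrite /degree /= big_split /= IHs => [|q sq]; last by apply: sC; rewrite inE sq orbT.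
rewrite mulSn; congr (_ + _)%N; rewrite -(unifC (sC p _)) ?mem_head //.
rewrite -sum1_card [in RHS]big_mkcond /=.
by apply: eq_bigr => x _; case: (x \in p).
Qed.

(* By uniformity both degrees have the same sum over the vertices. *)
Lemma perm_of_degree_le s t : {subset s <= C} -> {subset t <= C} ->
  size s = size t -> (forall x, (degree s x <= degree t x)%N) ->
  degree s =1 degree t /\ perm_eq s t.
Proof.
move=> sC tC size_st le_st.
suff eq_st : degree s =1 degree t by split=> //; apply: indepC.
move=> x; have : (\sum_y degree s y = \sum_y degree t y)%N.
  by rewrite !sum_degree // size_st.
rewrite (bigD1 x) //= [in RHS](bigD1 x) //= => eq_sum.
apply/eqP; rewrite eqn_leq le_st -(leq_add2r (\sum_(y | y != x) degree s y)).
by rewrite eq_sum leq_add2l; apply: leq_sum => y _.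
Qed.

Lemma stars_cross_free : {in stars &, forall a b, cross_free a b}.
Proof.
move=> _ _ /starP[a Ca ->] /starP[b Cb ->].
have [->|neq_ab] := eqVneq a b; first by rewrite /cross_free subxx.
have [->|a0] := eqVneq a f0; first by rewrite star0 /cross_free sub0set.
have [->|b0] := eqVneq b f0; first by rewrite star0 /cross_free sub0set orbT.
have [->|aT] := eqVneq a (~: f0); first by rewrite starT /cross_free subsetT orbT.
have [->|bT] := eqVneq b (~: f0); first by rewrite starT /cross_free subsetT.
have pol e : e \in C -> exists p q, [/\ p \in C, q \in C & forall x,
    ((x \in p) + (x \in q) <= [|| x \in e, x \in a | x \in b] + [&& x \in e, x \in a & x \in b])%N].
  move=> Ce; have [||p [q [Cp Cq pq]]] := @polarity [set e; a; b].
  - by apply/subsetP => f; rewrite !inE => /orP[/orP[]|] /eqP->.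
  - apply/card_gt1P; exists a, b; rewrite !inE !eqxx ?orbT; split=> //.
  exists p, q; split=> // x; apply: leq_trans (pq x) _.
  apply: leq_add; apply: leq_b2b.
    by case/bigcupP=> f; rewrite !inE => /orP[/orP[]|] /eqP-> ->; rewrite ?orbT.
  by move/forall_inP=> all; rewrite !all ?inE ?eqxx ?orbT.
have [p [q [Cp Cq pq]]] := pol f0 Cf0; have [r [s [Cr Cs rs]]] := pol _ Cf0C.
have [] := @perm_of_degree_le [:: p; q; r; s] [:: a; b; f0; ~: f0].
- by apply/allP; rewrite /= Cp Cq Cr Cs.
- by apply/allP; rewrite /= Ca Cb Cf0 Cf0C.
- by [].
- move=> x; have := leq_add (pq x) (rs x); rewrite /degree /= !inE !addn0 addnA.
  move=> le; rewrite -!addnA in le *; apply: leq_trans le _.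
  by case: (x \in a); case: (x \in b); case: (x \in f0).
move=> deg prm.
(* Equality of the total degrees forces equality in each of the two inequalities. *)
have {}pq x : ((x \in p) + (x \in q) =
    [|| x \in f0, x \in a | x \in b] + [&& x \in f0, x \in a & x \in b])%N.
  have := pq x; have := rs x; have := deg x; rewrite /degree /= !inE.
  case: (x \in p); case: (x \in q); case: (x \in r); case: (x \in s);
  by case: (x \in a); case: (x \in b); case: (x \in f0).
have neq_pq : p != q.
  have : uniq [:: p; q; r; s].
    rewrite (perm_uniq prm) /= !inE !negb_or neq_ab a0 aT b0 bT /= andbT.
    apply/eqP => /setP/(_ (Ordinal n_gt1)).
    by rewrite inE; case: (_ \in _).
  by rewrite /= inE !negb_or => /andP[/andP[]].
have memt u : u \in [:: p; q; r; s] -> [|| u == a, u == b, u == f0 | u == ~: f0].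
  by rewrite (perm_mem prm) !inE.
have f0_ne e : e != f0 -> ~ (forall x, x \in e = (x \in f0)).
  by move=> ne eqe; case/eqP: ne; apply/setP.
have Hp : p \in [:: p; q; r; s] by rewrite inE eqxx.
have Hq : q \in [:: p; q; r; s] by rewrite !inE eqxx orbT.
(* The pair [p], [q] tells which region is empty: [a], [b] gives disjoint stars; [f0], [~: f0] gives
   stars covering everything; [f0] with [a] or [b] gives nested stars. Pairing [~: f0] with [a] or
   [b] would force that edge to be [f0]. *)
move: (memt p Hp) (memt q Hq) neq_pq pq => {memt Hp Hq prm deg rs Cp Cq}.
move=> /or4P[]/eqP-> /or4P[]/eqP->; rewrite ?eqxx // => _ pq.
all: try by apply/or4P;
  multimatch goal with
  | _ => constructor 1 | _ => constructor 2 | _ => constructor 3 | _ => constructor 4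
  end;
  apply/subsetP => x; move: (pq x); rewrite !inE;
  case: (x \in f0); case: (x \in a); case: (x \in b).
all: (case: (f0_ne a a0) || case: (f0_ne b b0)) => x; move: (pq x); rewrite inE.
all: by case: (x \in f0); case: (x \in a); case: (x \in b).
Qed.

(** Polarity for [f0], [p], [q], [r] gives edges with [u + v + f0 <= p + q + r], since at most one
    of [p], [q], [r] differs from [f0] at each vertex. Equality would then put [f0] among the
    three. *)
Lemma no_disjoint_triple a b c :
    a \in proper_sets stars -> b \in proper_sets stars -> c \in proper_sets stars ->
    a \subset ~: b -> a \subset ~: c -> b \subset ~: c -> False.
Proof.
case/proper_setsP=> /starP[p Cp ->] p0 _ /proper_setsP[/starP[q Cq ->] q0 _].
case/proper_setsP=> /starP[r Cr ->] r0 _ /subsetP pq /subsetP pr /subsetP qr.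
rewrite !star_eq0 in p0 q0 r0.
have [||u [v [Cu Cv uv]]] := @polarity [set f0; p; q; r].
- by apply/subsetP => f; rewrite !inE => /orP[/orP[/orP[]|]|] /eqP->.
- by apply/card_gt1P; exists f0, p; rewrite !inE !eqxx ?orbT eq_sym; split.
have [|||x|_ prm] := @perm_of_degree_le [:: u; v; f0] [:: p; q; r].
- by apply/allP; rewrite /= Cu Cv Cf0.
- by apply/allP; rewrite /= Cp Cq Cr.
- by [].
- have cov : x \in cover [set f0; p; q; r] -> [|| x \in f0, x \in p, x \in q | x \in r].
    by case/bigcupP=> f; rewrite !inE => /orP[/orP[/orP[]|]|] /eqP-> ->; rewrite ?orbT.
  have cap : [forall f in [set f0; p; q; r], x \in f] -> [&& x \in f0, x \in p, x \in q & x \in r].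
    by move/forall_inP=> all; rewrite !all ?inE ?eqxx ?orbT.
  have {cov cap} := leq_trans (uv x) (leq_add (leq_b2b cov) (leq_b2b cap)).
  have := pq x; have := pr x; have := qr x; rewrite !inE /degree /= addn0 addnA.
  move: (x \in u) (x \in v) => [] [];
  by case: (x \in f0); case: (x \in p); case: (x \in q); case: (x \in r) => //= h1 h2 h3;
    first [by have := h1 isT | by have := h2 isT | by have := h3 isT].
by have := perm_mem prm f0; rewrite !inE eqxx !orbT !(eq_sym f0) (negPf p0) (negPf q0) (negPf r0).
Qed.

(* A tree vertex carries as many elements of f0 as of its complement, since
   both [star p] and the whole vertex set are balanced between the two. *)
Lemma opposite_exists x : exists y, forall p, p \in C -> (y \in p) = (x \notin p).
Proof.
pose g (y : 'I_n) : int := if y \in f0 then 1 else -1.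
have sum_g (m : {set 'I_n}) : \sum_(y in m) g y = #|m :&: f0|%:Z - #|m :\: f0|%:Z.
  rewrite (big_setID f0) /= (eq_bigr (fun=> 1)) => [|y]; last first.
    by rewrite inE /g => /andP[_ ->].
  rewrite [X in _ + X](eq_bigr (fun=> -1)) => [|y]; last first.
    by rewrite inE /g => /andP[/negPf-> _].
  by rewrite !sumr_const mulNrn -!natz.
have gstar p : p \in C -> \sum_(y in star p) g y = 0.
  move=> Cp; rewrite sum_g.
  have -> : star p :&: f0 = f0 :\: p.
    by apply/setP => y; rewrite !inE; case: (y \in f0); case: (y \in p).
  have -> : star p :\: f0 = p :\: f0.
    by apply/setP => y; rewrite !inE; case: (y \in f0); case: (y \in p).
  have := cardsID p f0; have := cardsID f0 p; rewrite setIC (unifC Cp) (unifC Cf0); lia.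
have gT : \sum_y g y = 0.
  by rewrite -[RHS](gstar _ Cf0C) starT; apply: eq_bigl => y; rewrite inE.
have gside (m : {set 'I_n}) : side stars m -> \sum_(y in m) g y = 0.
  case/orP=> /starP[p Cp ep]; first by rewrite ep gstar.
  have := gT; rewrite (bigID (fun y => y \in ~: m)) /= ep gstar // add0r.
  by move=> sum0; rewrite -[RHS]sum0; apply: eq_bigl => y; rewrite -ep inE negbK.
(* Outside the union of the sides that miss [x] lies exactly the tree vertex carrying [x]. *)
pose L := [set m | side stars m && (x \notin m)].
have lamL : laminar L.
  move=> a b /setIdP[sa xa] /setIdP[sb xb].
  have := cross_side stars_cross_free sa sb.
  case/or4P=> [->|->|->|ba]; rewrite ?orbT //.
  by have := subsetP ba x; rewrite inE xb (negPf xa) => /(_ isT).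
have [M [sML tM covM]] := laminar_partition lamL.
have gcov : \sum_(y in cover L) g y = 0.
  rewrite -covM big_trivIset //= big1 // => m /(subsetP sML)/setIdP[sm _].
  exact: gside.
have gout : \sum_(y in ~: cover L) g y = 0.
  have := gT; rewrite (bigID (fun y => y \in cover L)) /= gcov add0r => sum0.
  rewrite -[RHS]sum0; by apply: eq_bigl => y; rewrite inE.
have xout : x \in ~: cover L.
  by rewrite inE; apply/bigcupP => -[m /setIdP[_ /negPf->]].
have [/exists_inP[y yout neq]|none] := boolP [exists y in ~: cover L, (y \in f0) != (x \in f0)].
  exists y => p Cp; have : (y \in star p) = (x \in star p).
    have Sp : side stars (star p) by rewrite /side mem_stars Cp.
    have SpC : side stars (~: star p) by rewrite /side setCK mem_stars Cp orbT.
    move: yout; rewrite inE => /bigcupP yout.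
    have [xp|xp] := boolP (x \in star p).
      apply: contraT => yp; case: yout; exists (~: star p); last by rewrite inE.
      by rewrite inE SpC inE negbK.
    apply/negbTE/negP => yp; case: yout; exists (star p) => //.
    by rewrite inE Sp.
  by rewrite !inE; move: neq; case: (y \in f0); case: (x \in f0); case: (y \in p); case: (x \in p).
(* Were the whole tree vertex on one side of [f0], [g] would be a nonzero constant there, yet it
   sums to zero. *)
have same y : y \in ~: cover L -> g y = g x.
  move=> yout; move: none; rewrite negb_exists_in => /forall_inP/(_ y yout).
  by rewrite negbK /g => /eqP->.
move: gout; rewrite (eq_bigr (fun=> g x)) // sumr_const => /eqP.
rewrite mulrn_eq0 cards_eq0 => /orP[/eqP e0|]; first by rewrite e0 inE in xout.
by rewrite /g; case: ifP.
Qed.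

(** On [f0] the membership is flipped by [star], and an opposite vertex undoes the flip. *)
Lemma in_star_exists i : exists y, forall p, p \in C -> (y \in p) = (i \in star p).
Proof.
have [i0|i0] := boolP (i \in f0); last first.
  by exists i => p _; rewrite inE (negPf i0) addbF.
have [y yP] := opposite_exists i; exists y => p Cp.
by rewrite yP // inE i0 addbT.
Qed.

Lemma notin_star_exists i : exists y, forall p, p \in C -> (y \in p) = (i \notin star p).
Proof.
have [y yP] := in_star_exists i; have [z zP] := opposite_exists y.
by exists z => p Cp; rewrite zP // yP.
Qed.

(* Contracting everything but the five vertices leaves a pentagon, which has
   covering number 3 and no three disjoint edges. *)
Lemma no_five_hole (i s c t l : 'I_n) : ~ five_hole stars i s c t l.
Proof.
case=> two pat.
have [u1 u1P] := notin_star_exists i; have [u2 u2P] := in_star_exists s.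
have [u3 u3P] := notin_star_exists c; have [u4 u4P] := in_star_exists t.
have [u5 u5P] := notin_star_exists l.
pose us := [:: u1; u2; u3; u4; u5].
have usP p : p \in C -> [seq x \in p | x <- us] = parity_vector i s c t l (star p).
  by move=> Cp; rewrite /us /= u1P // u2P // u3P // u4P // u5P.
have {}two p : p \in C -> (2 <= count (fun x => x \in p) us)%N.
  by move=> Cp; rewrite -mem_stars in Cp; have := two _ Cp; rewrite -usP ?count_map // -mem_stars.
have {}pat v : v \in [:: [:: true; false; false; true; false];
                       [:: true; false; true; false; false];
                       [:: false; false; true; false; true];
                       [:: false; true; false; false; true];
                       [:: false; true; false; true; false]] ->
    exists2 p, p \in C & [seq x \in p | x <- us] = v.
  by move=> /pat[_ /starP[p Cp ->] <-]; exists p; rewrite ?usP.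
have [p1 Cp1 e1] := pat [:: true; false; false; true; false] isT.
have [p2 Cp2 e2] := pat [:: true; false; true; false; false] isT.
have [p3 Cp3 e3] := pat [:: false; false; true; false; true] isT.
have [p4 Cp4 e4] := pat [:: false; true; false; false; true] isT.
have [p5 Cp5 e5] := pat [:: false; true; false; true; false] isT.
(* The first three patterns already tell the five vertices apart. *)
have uniq_us : uniq us.
  apply: (@map_uniq _ _ (fun x => [:: x \in p1; x \in p2; x \in p3])).
  move: e1 e2 e3; rewrite /us /= => -[-> -> -> -> ->] [-> -> -> -> ->].
  by move=> [-> -> -> -> ->].
have n_ge3 : (3 <= n)%N.
  have := max_card (mem us); rewrite card_ord (card_uniqP uniq_us).
  exact: leq_trans.
have d0W : [disjoint set0 & [set x | x \notin us]] by rewrite disjoints_subset sub0set.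
have [f Cf _|S covS|M [M3 MP MI]] := packing_minor packC d0W n_ge3.
- apply/negP => /subsetP fW; have := two f Cf.
  rewrite (eq_in_count (a2 := pred0)) ?count_pred0 // => x xus /=.
  by apply/negP => /fW; rewrite inE xus.
- have le_S : (count (fun x => x \in S) us <= #|S|)%N.
    rewrite -size_filter -(card_uniqP (filter_uniq _ uniq_us)).
    by apply/subset_leq_card/subsetP => x; rewrite mem_filter => /andP[].
  apply: leq_trans le_S.
  have hit p : p \in C -> has (fun x => (x \in S) && (x \in p)) us.
    move=> Cp; have [|x Sx] := covS p Cp; first by rewrite disjoint_sym disjoints_subset sub0set.
    rewrite !inE negbK => /andP[xus px]; apply/hasP; exists x; last by rewrite Sx.
    by rewrite !inE.
  move: (hit p1 Cp1) (hit p2 Cp2) (hit p3 Cp3) (hit p4 Cp4) (hit p5 Cp5).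
  move: e1 e2 e3 e4 e5; rewrite /us /=.
  move=> [-> -> -> -> ->] [-> -> -> -> ->] [-> -> -> -> ->] [-> -> -> -> ->] [-> -> -> -> ->].
  by case: (u1 \in S); case: (u2 \in S); case: (u3 \in S); case: (u4 \in S); case: (u5 \in S).
have le1 x : x \in us -> (\sum_(f in M) (x \in f) <= 1)%N.
  move=> xus; have [/exists_inP[f Mf xf]|none] := boolP [exists f in M, x \in f].
    rewrite (bigD1 f) //= xf big1 // => h /andP[Mh neq].
    apply/eqP; rewrite eqb0; apply/negP => xh.
    have := subsetP (MI h f Mh Mf neq) x; rewrite in_setI xh xf => /(_ isT).
    by rewrite in_set xus.
  rewrite big1 // => f Mf; apply/eqP; rewrite eqb0.
  by apply: contra none => xf; apply/exists_inP; exists f.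
(* Three edges of [M] would use six of the five vertices, two each, without sharing any. *)
have : (\sum_(f in M) 2 <= \sum_(f in M) count (fun x => x \in f) us)%N.
  by apply: leq_sum => f /MP[Cf _]; apply: two.
rewrite sum_nat_const.
have -> : (\sum_(f in M) count (fun x => x \in f) us = \sum_(x <- us) \sum_(f in M) (x \in f))%N.
  rewrite exchange_big; apply: eq_bigr => f _.
  by rewrite -sum1_count big_mkcond; apply: eq_bigr => x _; case: (_ \in _).
have : (\sum_(x <- us) \sum_(f in M) (x \in f) <= \sum_(x <- us) 1)%N.
  by rewrite big_seq [X in (_ <= X)%N]big_seq; apply: leq_sum => x; apply: le1.
rewrite sum1_size => le5 le_M; have := leq_trans le_M le5.
by rewrite leqNgt (leq_trans (_ : 5 < 3 * 2)%N) // leq_mul2r M3.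
Qed.

(** Summing over [us] a weight that is a combination of the edges isolates the coefficient of [p],
    up to [e] times the sum of all coefficients. *)
Definition certificate p (us : seq 'I_n) (e : bool) : Prop :=
  forall q, q \in C -> count (fun x => x \in q) us = (e + (q == p))%N.

Lemma certificate_base : exists us e, certificate f0 us e.
Proof.
have [[i iP]|[i [j [l ijl]]]|[i [s [c [t [l]]]]]] := empty_set_certificate stars0 starsT
  stars_cross_free stars_independent (Ordinal n_gt1) no_disjoint_triple.
- have [y yP] := notin_star_exists i; exists [:: y], false => q Cq /=.
  by rewrite yP // iP ?mem_stars // negbK star_eq0 addn0.
- have [y1 y1P] := in_star_exists j; have [y2 y2P] := notin_star_exists i.
  have [y3 y3P] := notin_star_exists l; exists [:: y1; y2; y3], true => q Cq /=.
  by rewrite y1P // y2P // y3P // addn0 addnA ijl ?mem_stars // star_eq0 add1n.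
by move/no_five_hole.
Qed.

End Star.

Section Certificates.

Variable f0 : {set 'I_n}.
Hypotheses (Cf0 : f0 \in C) (Cf0C : ~: f0 \in C).

(** For [p] other than [f0] and its complement, the two ends of the arc of [p] suffice: every other
    member has both or neither of them. For [~: f0] the base case applies with the two reference
    edges exchanged. *)
Lemma certificate_exists p : p \in C -> exists us e, certificate p us e.
Proof.
move=> Cp; have [->|p0] := eqVneq p f0; first exact: certificate_base.
have [->|pT] := eqVneq p (~: f0); first by apply: certificate_base; rewrite ?setCK.
have Sp : star f0 p \in stars f0 by rewrite mem_stars.
have [||i [j [pi pj ij _ _]]] := separated_once (stars0 Cf0) (starsT Cf0C)
  (stars_cross_free Cf0 Cf0C) (stars_independent Cf0 Cf0C) Sp.
- by rewrite star_eq0.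
- by rewrite star_eqT.
have [y1 y1P] := in_star_exists Cf0 Cf0C i; have [y2 y2P] := notin_star_exists Cf0 Cf0C j.
exists [:: y1; y2], true => q Cq /=; rewrite y1P // y2P // addn0.
have [->|neq] := eqVneq q p; first by rewrite pi pj.
rewrite (ij (star f0 q)) ?mem_stars // ?(inj_eq (inv_inj (starK f0))) //.
by case: (j \in _).
Qed.

(** Reflecting [w] to [k - w] on [f0] makes it a function on the tree vertices: two elements of one
    vertex lie in the same edges or are opposite. [affine_span] then applies, and the total [k] lets
    the reflection be undone. *)
Lemma integral_span (w : 'I_n -> int) (k : int) :
    (forall x y, (forall p, p \in C -> (y \in p) = (x \notin p)) -> w x + w y = k) ->
  exists z : {set 'I_n} -> int, \sum_(p in C) z p = k /\
    forall x, w x = \sum_(p in C) z p *+ (x \in p).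
Proof.
move=> opp; pose g x := if x \in f0 then k - w x else w x.
have [i j ij||z [sum_z zP]] := @affine_span _ (stars f0) (stars0 Cf0) (starsT Cf0C)
  (stars_cross_free Cf0 Cf0C) (stars_independent Cf0 Cf0C) g k.
- have ijC p : p \in C -> (i \in p) (+) (i \in f0) = (j \in p) (+) (j \in f0).
    by move=> Cp; have := ij (star f0 p); rewrite !inE; apply; rewrite mem_stars.
  have [y yP] := opposite_exists Cf0 Cf0C i.
  have wi := opp _ _ yP; rewrite /g.
  have [eqf|neqf] := eqVneq (i \in f0) (j \in f0).
    rewrite eqf (_ : w i = w j) //.
    have wj : w j + w y = k.
      apply: opp => p Cp; rewrite yP //; congr (~~ _).
      by have := ijC p Cp; rewrite eqf => /addIb.
    by apply: (addIr (w y)); rewrite wi wj.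
  have wij : w i + w j = k.
    apply: opp => p Cp; have := ijC p Cp; move: neqf.
    by case: (i \in f0); case: (j \in f0); case: (i \in p); case: (j \in p).
  move: neqf; rewrite -wij; case: (i \in f0); case: (j \in f0) => //= _.
    by rewrite addrAC subrr add0r.
  by rewrite addrK.
- by apply/eqP => /setP/(_ (Ordinal n_gt1)); rewrite !inE.
have reidx (h : {set 'I_n} -> int) : \sum_(p in stars f0) h p = \sum_(p in C) h (star f0 p).
  by rewrite big_imset //= => p q _ _; apply: inv_inj (starK f0) _ _.
exists (fun p => z (star f0 p)); split; first by rewrite -reidx.
move=> x; have := zP x; rewrite reidx /g; case: ifP => x0.
  move=> kw; have -> : w x = k - (k - w x) by rewrite opprB addrC subrK.
  rewrite kw -sum_z reidx -sumrB; apply: eq_bigr => p _.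
  rewrite inE x0 addbT; case: (x \in p) => /=; rewrite ?subr0 ?subrr //.
by move=> ->; apply: eq_bigr => p _; rewrite inE x0 addbF.
Qed.

End Certificates.
End ComplementaryEdges.

(** * Weights and covers *)

Section Weights.

Variables (n : nat) (C : {set {set 'I_n}}).
Implicit Types (w : 'I_n -> nat) (B f : {set 'I_n}).

Definition opposite (x y : 'I_n) : bool :=
  [forall f in C, (y \in f) == (x \notin f)].

Lemma oppositeP x y :
  reflect (forall f, f \in C -> (y \in f) = (x \notin f)) (opposite x y).
Proof.
by apply: (iffP forall_inP) => opp f Cf; [apply/eqP|rewrite opp]; rewrite ?opp.
Qed.

Definition covers_weigh (k : nat) w : bool :=
  [forall (B | vertex_cover C B), k <= \sum_(x in B) w x]%N.

Lemma vertex_cover_meet B f : vertex_cover C B -> f \in C ->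
  exists2 x, x \in B & x \in f.
Proof.
by move=> /forall_inP cB /cB/set0Pn[x /setIP[]]; exists x.
Qed.

Lemma sum_mem B w : (\sum_(x in B) w x = \sum_x (x \in B) * w x)%N.
Proof. by rewrite big_mkcond; apply: eq_bigr => x _; case: (x \in B); rewrite ?mul1n. Qed.

Lemma opposite_cover x y : opposite x y -> vertex_cover C [set x; y].
Proof.
move=> /oppositeP opp; apply/forall_inP => f Cf; apply/set0Pn.
have [xf|xf] := boolP (x \in f); first by exists x; rewrite !inE eqxx xf.
by exists y; rewrite !inE eqxx orbT opp.
Qed.

(* Since each edge contains exactly one of x and y, the multiset B + B' - {x, y}
   still meets every edge. *)
Lemma exchange_cover x y B B' : x != y -> opposite x y -> vertex_cover C B ->
    vertex_cover C B' -> x \in B -> y \in B' ->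
  exists2 D, vertex_cover C D & forall w,
    (\sum_(z in D) w z + (w x + w y) <= \sum_(z in B) w z + \sum_(z in B') w z)%N.
Proof.
move=> neq_xy /oppositeP opp cB cB' Bx B'y.
pose D := [set z | ((z == x) + (z == y) < (z \in B) + (z \in B'))%N].
have Dx : x \in B' -> x \in D by move=> B'x; rewrite inE eqxx (negPf neq_xy) Bx B'x.
have Dy : y \in B -> y \in D.
  by move=> By; rewrite inE eqxx eq_sym (negPf neq_xy) By B'y.
have Dz z : z != x -> z != y -> (z \in B) || (z \in B') -> z \in D.
  move=> /negPf zx /negPf zy; rewrite inE zx zy.
  by case: (z \in B); case: (z \in B').
exists D.
  apply/forall_inP => f Cf; apply/set0Pn; have [xf|xf] := boolP (x \in f).
    have yf : y \notin f by rewrite opp // xf.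
    have [z B'z zf] := vertex_cover_meet cB' Cf.
    exists z; rewrite inE zf andbT; have [zx|zx] := eqVneq z x.
      by rewrite zx Dx // -zx.
    by apply: Dz; rewrite ?B'z ?orbT //; apply: contraNneq yf => <-.
  have [z Bz zf] := vertex_cover_meet cB Cf.
  exists z; rewrite inE zf andbT; have [zy|zy] := eqVneq z y.
    by rewrite zy Dy // -zy.
  by apply: Dz; rewrite ?Bz //; apply: contraNneq xf => <-.
move=> w; rewrite !sum_mem.
have pick u : (w u = \sum_z (z == u) * w z)%N.
  rewrite (bigD1 u) //= eqxx mul1n big1 ?addn0 // => z /negPf ->.
  by rewrite mul0n.
rewrite (pick x) (pick y) -!big_split /=; apply: leq_sum => z _.
rewrite -!mulnDl leq_mul2r; apply/orP; right; rewrite inE.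
have [->|zx] := eqVneq z x; first by rewrite Bx (negPf neq_xy); case: (x \in B').
have [->|zy] := eqVneq z y; first by rewrite B'y; case: (y \in B).
by case: (z \in B); case: (z \in B').
Qed.

Definition decr w (u : 'I_n) : 'I_n -> nat := fun z => (w z - (z == u))%N.

(** Lowering [w u] by one can only spoil a cover through [u], and only one of weight exactly [k]. *)
Lemma tight_cover k w u : (0 < w u)%N -> covers_weigh k w ->
    ~~ covers_weigh k (decr w u) ->
  exists B, [/\ vertex_cover C B, u \in B & (\sum_(z in B) w z = k)%N].
Proof.
move=> wu /forall_inP kw /forall_inPn[B cB]; rewrite -ltnNge => lt_k.
have le_k := kw B cB; exists B.
have eq_w z : z != u -> decr w u z = w z by move=> /negPf zu; rewrite /decr zu subn0.
have [Bu|Bu] := boolP (u \in B); last first.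
  move: lt_k; rewrite (eq_bigr w) ?ltnNge ?le_k // => z Bz.
  by apply: eq_w; apply: contraNneq Bu => <-.
have split_u (F : 'I_n -> nat) :
  (\sum_(z in B) F z = F u + \sum_(z in B | z != u) F z)%N by rewrite (bigD1 u).
split=> //; move: lt_k le_k; rewrite !split_u.
rewrite /decr eqxx (eq_bigr w) => [|z /andP[_ zu]]; last exact: eq_w.
by move: wu; set S := (\sum_(z in B | _) _)%N => /=; lia.
Qed.

(** The induction is on the total weight. If [w x + w y] exceeds [k] and neither weight can be
    lowered, tight covers pass through [x] and [y], and exchanging them gives a cover of weight at
    most [2k - (w x + w y)], below [k]. *)
Lemma balanced_weight k w : (exists f, f \in C) -> covers_weigh k w ->
  exists w', [/\ forall x, (w' x <= w x)%N, covers_weigh k w' &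
    forall x y, opposite x y -> (w' x + w' y = k)%N].
Proof.
move=> [f0 Cf0]; have [m] := ubnP (\sum_x w x); elim: m w => // m IHm w lt_m kw.
have [/existsP[x /existsP[y /andP[opp neq]]]|ok] :=
    boolP [exists x, [exists y, opposite x y && (w x + w y != k)%N]]; last first.
  exists w; split=> // x y opp; apply/eqP; apply: contraR ok => neq.
  by apply/existsP; exists x; apply/existsP; exists y; rewrite opp.
have neq_xy : x != y.
  apply/eqP => exy; have /oppositeP/(_ f0 Cf0) := opp.
  by rewrite exy; case: (_ \in _).
have lt_k : (k < w x + w y)%N.
  rewrite ltn_neqAle eq_sym neq; have /forall_inP/(_ _ (opposite_cover opp)) := kw.
  by rewrite big_setU1 ?inE //= big_set1.
have le_part B u : u \in B -> (w u <= \sum_(z in B) w z)%N.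
  by move=> Bu; rewrite (bigD1 u) //= leq_addr.
have step u : (0 < w u)%N -> covers_weigh k (decr w u) ->
  exists w', [/\ forall x, (w' x <= w x)%N, covers_weigh k w' &
    forall x y, opposite x y -> (w' x + w' y = k)%N].
  move=> wu kwu; have [|w' [le_w' kw' ok]] := IHm _ _ kwu.
    rewrite -ltnS; apply: leq_trans lt_m; rewrite ltnS.
    rewrite [X in (X < _)%N](bigD1 u) //= [X in (_ < X)%N](bigD1 u) //= /decr eqxx.
    rewrite (eq_bigr w) => [|z /negPf->]; last by rewrite subn0.
    by rewrite ltn_add2r; lia.
  by exists w'; split=> // z; apply: leq_trans (le_w' z) (leq_subr _ _).
have [kwx|kwx] := boolP ((0 < w x)%N && covers_weigh k (decr w x)).
  by case/andP: kwx; apply: step.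
have [kwy|kwy] := boolP ((0 < w y)%N && covers_weigh k (decr w y)).
  by case/andP: kwy; apply: step.
have tight u : ~~ ((0 < w u)%N && covers_weigh k (decr w u)) -> (0 < w u)%N ->
    exists B, [/\ vertex_cover C B, u \in B & (\sum_(z in B) w z = k)%N].
  by move=> + wu; rewrite wu; apply: tight_cover.
(* If one weight is zero the other exceeds [k], too much for a member of a tight cover. *)
have [wx|wx] := posnP (w x).
  have [|B [cB By eqk]] := tight y kwy; first by lia.
  by have := le_part B y By; rewrite eqk; lia.
have [wy|wy] := posnP (w y).
  have [B [cB Bx eqk]] := tight x kwx wx.
  by have := le_part B x Bx; rewrite eqk; lia.
have [B [cB Bx eqB]] := tight x kwx wx; have [B' [cB' By eqB']] := tight y kwy wy.
have [D cD /(_ w)] := exchange_cover neq_xy opp cB cB' Bx By.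
have /forall_inP/(_ D cD) := kw; rewrite eqB eqB'; lia.
Qed.

End Weights.

(** * Linear programming duality and linear independence *)

Section LinearPrograms.

Variables (R : realFieldType) (n : nat) (C : {set {set 'I_n}}).

Lemma weak_duality (a : 'I_n -> nat) x (y : 'cV[R]_#|C|) :
  min_feasible (incidence_matrix R C) x -> max_feasible (incidence_matrix R C) a y ->
  max_value y <= min_value a x.
Proof.
set A := incidence_matrix R C => -[x0 xA] [y0 Ay].
apply: (@le_trans _ _ ((x *m A *m y) 0 0)).
  rewrite mxE; apply: ler_sum => k _.
  by rewrite -{1}[y k 0]mul1r ler_wpM2r.
rewrite -mulmxA mxE; apply: ler_sum => i _.
by rewrite mulrC ler_wpM2r.
Qed.

(** The indicator of a cover and an integral edge packing of equal value certify each other's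
    optimality by weak duality. *)
Lemma max_flow_min_cut_of_packing :
  (forall a : 'I_n -> nat, exists B (z : {set 'I_n} -> int),
    [/\ vertex_cover C B, forall p, p \in C -> 0 <= z p,
      forall i, \sum_(p in C) z p *+ (i \in p) <= (a i)%:Z
      & \sum_(p in C) z p = (\sum_(i in B) a i)%:Z]) ->
  max_flow_min_cut R C.
Proof.
move=> pack a; have [B [z [cB z_ge0 z_le sum_z]]] := pack a.
pose x : 'rV[int]_n := \row_i (i \in B)%:R.
pose y : 'cV[int]_#|C| := \col_k z (enum_val k).
have fx : min_feasible (incidence_matrix R C) (map_mx intr x).
  split=> [i|k]; first by rewrite !mxE ler0z ler0n.
  have Cf : enum_val k \in C by apply: enum_valP.
  have [j Bj fj] := vertex_cover_meet cB Cf.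
  rewrite mxE (bigD1 j) //= !mxE Bj fj mulr1 lerDl sumr_ge0 // => i _.
  by rewrite !mxE mulr_ge0 ?ler0z ?ler0n.
have fy : max_feasible (incidence_matrix R C) a (map_mx intr y).
  split=> [k|i]; first by rewrite !mxE ler0z z_ge0 // enum_valP.
  rewrite mxE (_ : \sum_k _ = (\sum_(p in C) z p *+ (i \in p))%:~R).
    by rewrite -[(a i)%:R]/((a i)%:Z%:~R) ler_int.
  rewrite (big_enum_val (fun p => z p *+ (i \in p))) rmorph_sum /=.
  apply: eq_bigr => k _; rewrite !mxE; case: (i \in _); rewrite ?mul1r //.
  by rewrite mul0r.
have eq_val : max_value (map_mx intr y : 'cV[R]_#|C|) = min_value a (map_mx intr x).
  transitivity ((\sum_(p in C) z p)%:~R : R).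
    rewrite (big_enum_val z) rmorph_sum /=.
    by apply: eq_bigr => k _; rewrite !mxE.
  rewrite sum_z /min_value -[_%:~R]/(_%:R) natr_sum big_mkcond /=.
  by apply: eq_bigr => i _; rewrite !mxE; case: (i \in B); rewrite ?mulr1 ?mulr0.
split; [exists x | exists y]; split=> //.
  by move=> x' fx'; rewrite -eq_val; apply: weak_duality.
by move=> y' fy'; rewrite eq_val; apply: weak_duality.
Qed.

(** The differences of multiplicities are the coefficients of a vanishing combination of the
    columns, and natural numbers embed in [R]. *)
Lemma free_degree :
    free [tuple col k (incidence_matrix R C) | k < #|C|] ->
  forall s t : seq {set 'I_n}, {subset s <= C} -> {subset t <= C} ->
  degree s =1 degree t -> perm_eq s t.
Proof.
move=> /freeP freeC s t sC tC deg_st.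
have degE u x : {subset u <= C} ->
    (degree u x)%:R = \sum_(p in C) (count_mem p u)%:R * (x \in p)%:R :> R.
  elim: u => [_|p u IHu puC] /=; first by rewrite big1 // => p _; rewrite mul0r.
  rewrite /degree /= natrD [X in _ + X]IHu => [|q uq]; last by apply: puC; rewrite inE uq orbT.
  under [RHS]eq_bigr do rewrite natrD mulrDl.
  rewrite big_split /=; congr (_ + _).
  rewrite (bigD1 p) ?puC ?mem_head //= eqxx mul1r big1 ?addr0 // => q /andP[_ /negPf].
  by rewrite eq_sym => ->; rewrite mul0r.
have key (k : 'I_#|C|) : (count_mem (enum_val k) s)%:R - (count_mem (enum_val k) t)%:R = 0 :> R.
  apply: (freeC (fun k => (count_mem (enum_val k) s)%:R - (count_mem (enum_val k) t)%:R)).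
  apply/matrixP => x j; rewrite summxE mxE.
  transitivity (\sum_(p in C) ((count_mem p s)%:R - (count_mem p t)%:R) * (x \in p)%:R : R).
    rewrite (big_enum_val (fun p => ((count_mem p s)%:R - (count_mem p t)%:R) * (x \in p)%:R)).
    by apply: eq_bigr => i _; rewrite -tnth_nth tnth_mktuple !mxE.
  under eq_bigr do rewrite mulrBl.
  by rewrite sumrB -!degE // deg_st subrr.
apply/allP => p; rewrite mem_cat => stp.
have Cp : p \in C by case/orP: stp => [/sC|/tC].
have := key (enum_rank_in Cp p); rewrite enum_rankK_in // => /eqP.
by rewrite subr_eq0 eqr_nat.
Qed.

End LinearPrograms.

(** * Complementary edges and the final assembly *)

Lemma alpha0_le n (C : {set {set 'I_n}}) : (alpha0 C <= n)%N.
Proof.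
rewrite /alpha0; elim/big_ind: _ => //.
  by move=> x y xn yn; rewrite geq_min xn.
by move=> S _; rewrite -[leqRHS]card_ord max_card.
Qed.

Lemma alpha0_le_cover n (C : {set {set 'I_n}}) S :
  vertex_cover C S -> (alpha0 C <= #|S|)%N.
Proof.
move=> cS; have [T minT sTS] := minset_exists cS.
apply: leq_trans (subset_leq_card sTS); rewrite /alpha0.
elim: (index_enum _) (mem_index_enum T) => // A r IHr.
rewrite inE big_cons => /orP[/eqP <-|/IHr le_r].
  by rewrite /minimal_vertex_cover minT geq_minl.
by case: ifP => // _; rewrite geq_min le_r orbT.
Qed.

(** The Konig property of [C] itself gives two disjoint edges. They fill the vertex set because the
    perfect matching has at most two edges, whence [n <= 2d]. *)
Lemma complementary_edges (K : fieldType) n d (C : {set {set 'I_n}}) :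
    packing_property K C -> uniform d C -> alpha0 C = 2%N -> set0 \notin C ->
    (exists M, perfect_matching C M) ->
  exists2 f, f \in C & ~: f \in C.
Proof.
move=> packC unifC alphaC C0 [M0 [sM0 tM0 covM0]].
have n_gt1 : (1 < n)%N by rewrite -alphaC alpha0_le.
have d0 : [disjoint (set0 : {set 'I_n}) & (set0 : {set 'I_n})].
  by rewrite disjoints_subset sub0set.
have [f Cf _|S covS|M [M2 MP MI]] := packing_minor packC d0 n_gt1.
- by rewrite subset0; apply: contraNneq C0 => <-.
- apply: leq_trans (_ : (alpha0 C <= _)%N); first by rewrite alphaC.
  have cS : vertex_cover C S.
    apply/forall_inP => f Cf; have [|x Sx] := covS f Cf.
      by rewrite disjoint_sym disjoints_subset sub0set.
    by rewrite setD0 => fx; apply/set0Pn; exists x; rewrite inE Sx.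
  exact: alpha0_le_cover.
have /card_gt1P[p [q [Mp Mq neq]]] := M2.
have [Cp _] := MP p Mp; have [Cq _] := MP q Mq.
exists p => //; suff <- : q = ~: p by [].
have [S cS cardS] := alpha0_attained C0.
(* Disjoint edges need distinct vertices of a cover of size two. *)
have le2 : (#|M0| <= 2)%N.
  rewrite -alphaC -cardS -!sum1_card.
  apply: (@leq_trans (\sum_(f in M0) \sum_(x in S) (x \in f))%N).
    apply: leq_sum => f /(subsetP sM0) Cf.
    have [x Sx fx] := vertex_cover_meet cS Cf.
    by rewrite (bigD1 x) //= fx.
  rewrite exchange_big /=; apply: leq_sum => x _.
  apply: leq_trans (leq_b1 (x \in cover M0)); rewrite -degree_trivIset //.
  rewrite /degree -sum1_count [X in (_ <= X)%N]big_mkcond big_enum /=.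
  by apply: leq_sum => f _; case: (x \in f).
have card_n : n = (#|M0| * d)%N.
  have /eqP := tM0; rewrite covM0 cardsT card_ord => sum_n; rewrite -[LHS]sum_n.
  by rewrite -sum_nat_const; apply: eq_bigr => f /(subsetP sM0)/unifC.
have := MI p q Mp Mq neq; rewrite subset0 => /eqP pq0.
apply/eqP; rewrite eqEcard -disjoints_subset -setI_eq0 setIC pq0 eqxx /=.
rewrite (unifC q Cq) -(leq_add2l #|p|) cardsC card_ord (unifC p Cp) addnn -mul2n.
by rewrite [leqLHS]card_n leq_mul2r le2 orbT.
Qed.

Theorem corollary4p3 (R : realFieldType) (K : fieldType) (n d : nat)
    (C : {set {set 'I_n}})
    (C_clutter : clutter C)
    (C_no_isolated : no_isolated_vertices C)
    (C_uniform : uniform d C)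
    (C_perfect_matching : exists M : {set {set 'I_n}}, perfect_matching C M)
    (C_packing : packing_property K C)
    (C_alpha0 : alpha0 C = 2%N)
    (C_independent : free [tuple col k (incidence_matrix R C) | k < #|C|]) :
  max_flow_min_cut R C.
Proof.
have n_gt1 : (1 < n)%N by rewrite -C_alpha0 alpha0_le.
have C0 : set0 \notin C.
  apply/negP => C0; have [f Cf xf] := C_no_isolated (Ordinal n_gt1).
  by rewrite -(C_clutter _ _ C0 Cf (sub0set f)) inE in xf.
have [f0 Cf0 Cf0C] := complementary_edges C_packing C_uniform C_alpha0 C0 C_perfect_matching.
have indepC := free_degree C_independent.
apply: max_flow_min_cut_of_packing => a.
have coverT : vertex_cover C setT.
  by apply/forall_inP => f Cf; rewrite setTI; apply: contraNneq C0 => <-.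
case: (arg_minnP (fun B : {set 'I_n} => (\sum_(x in B) a x)%N) coverT) => B cB minB.
set k := (\sum_(x in B) a x)%N in minB.
have kw : covers_weigh C k a by apply/forall_inP.
have [w [le_w {}kw opp_w]] := balanced_weight (ex_intro _ f0 Cf0) kw.
have [|z [sum_z zE]] := integral_span C_packing C_uniform indepC n_gt1 Cf0 Cf0C
  (w := fun x => (w x)%:Z) (k := k%:Z).
  by move=> x y /oppositeP opp; rewrite -PoszD opp_w.
exists B, z; split=> // [p Cp|i]; last by rewrite -zE lez_nat.
have [us [e us_p]] := certificate_exists C_packing C_uniform indepC n_gt1 Cf0 Cf0C Cp.
(* Weigh the certificate: each edge [q] contributes [z q] as often as it meets [us]. *)
have sum_us : (\sum_(u <- us) w u)%:Z = k%:Z *+ e + z p.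
  rewrite -sum_z -sumrMnl.
  have -> : z p = \sum_(q in C) z q *+ (q == p).
    rewrite (bigD1 p) //= eqxx big1 ?addr0 // => q /andP[_ /negPf ->].
    by rewrite mulr0n.
  rewrite -big_split /= -natz natr_sum.
  under eq_bigr do rewrite natz zE.
  rewrite exchange_big /=; apply: eq_bigr => q Cq.
  rewrite -mulrnDr -us_p // sumrMnr; congr (_ *+ _).
  by rewrite -sum1_count [RHS]big_mkcond; apply: eq_bigr => u _; case: (u \in q).
case: e us_p sum_us => [us_p sum_us|us_p]; last by rewrite add0r => <-.
(* With [e] true, [us] meets every edge, so its weight is at least [k] and the excess [z p] is
   nonnegative. *)
have cus : vertex_cover C [set u in us].
  apply/forall_inP => f Cf; apply/set0Pn.
  have : has (fun x => x \in f) us by rewrite has_count us_p.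
  by case/hasP=> x usx fx; exists x; rewrite !inE usx.
have /forall_inP/(_ _ cus) le_k := kw.
(* Only an inequality is claimed, as the list [us] may repeat a vertex. *)
have le_us : (\sum_(u in [set u in us]) w u <= \sum_(u <- us) w u)%N.
  elim: us {us_p sum_us cus le_k} => [|v us IHus].
    by rewrite big_nil big1 // => u; rewrite inE.
  rewrite big_cons; apply: leq_trans (leq_add (leqnn _) IHus).
  have -> : w v = (\sum_(u in [set v]) w u)%N by rewrite big_set1.
  rewrite !sum_mem -big_split; apply: leq_sum => u _ /=.
  rewrite -mulnDl leq_mul2r; apply/orP; right; rewrite !inE.
  by case: (u == v); case: (u \in us).
by have := leq_trans le_k le_us; rewrite -lez_nat sum_us mulr1n lerDl.
Qed.
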